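(* Let $f(z)=z+\sum_{n\ge 2}a_nz^n\in\mathcal{BT}_{\mathfrak{B}}$ and let $\gamma_1,\gamma_2,\gamma_3$ be its logarithmic coefficients. Then $$|H_{2,1}(F_f/2)|=|\gamma_1\gamma_3-\gamma_2^2|\le\frac{1}{144}.$$ The inequality is sharp, with equality for $f_2(z)=\int_0^z\sqrt{1+\tanh(t^2)}\,dt$.
   Context: $\mathbb{D}=\{z\in\mathbb{C}:|z|<1\}$. $\mathcal{S}$ is the class of univalent analytic functions $f$ on $\mathbb{D}$ normalized by $f(0)=0$, $f'(0)=1$, i.e. $f(z)=z+\sum_{n\ge2}a_nz^n$. For analytic $g,h$ on $\mathbb{D}$, $g\prec h$ means there is an analytic $\omega:\mathbb{D}\to\mathbb{D}$ with $\omega(0)=0$ and $g=h\circ\omega$. Let $\mathfrak{B}(z)=\sqrt{1+\tanh z}$ (principal branch, $\mathfrak{B}(0)=1$). The class $\mathcal{BT}_{\mathfrak{B}}$ is $\{f\in\mathcal{S}: f'(z)\prec \mathfrak{B}(z)\}$. The logarithmic coefficients are defined by $F_f(z):=\log\frac{f(z)}{z}=2\sum_{n\ge1}\gamma_nz^n$; explicitly $\gamma_1=\tfrac12 a_2$, $\gamma_2=\tfrac12(a_3-\tfrac12a_2^2)$, $\gamma_3=\tfrac12(a_4-a_2a_3+\tfrac13a_2^3)$. The Hankel determinant $H_{2,1}(F_f/2):=\gamma_1\gamma_3-\gamma_2^2=\frac{1}{48}(a_2^4-12a_3^2+12a_2a_4)$. *)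

(* Defs.v *)
(* MathComp + MathComp-Analysis, complex numbers CR := R[i] over
   Stdlib's reals R (which is both a realType and an rcfType, so that the
   real-closed library's complex numbers R[i] are a numClosedFieldType and
   CR^o is a normed module over CR, giving complex differentiability). *)
From Stdlib Require Import Reals.
From mathcomp Require Import all_boot all_order all_algebra.
From mathcomp Require Import all_classical all_reals all_analysis.
From mathcomp Require Import Rstruct Rstruct_topology.
From mathcomp Require Export complex.
Import Order.TTheory GRing.Theory Num.Theory.
Import numFieldNormedType.Exports.
Local Open Scope ring_scope.
Local Open Scope classical_set_scope.

Set Implicit Arguments.
Unset Strict Implicit.
Unset Printing Implicit Defensive.

Notation CR := (Rdefinitions.R)[i].

Definition unit_disk : set CR := [set z : CR | `|z| < 1].

Definition psum (a : nat -> CR) (z : CR) : CR :=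
  limn (series (fun k => (a k * z ^+ k : CR^o))).

(* complex exponential, tanh, and B(z) = sqrt(1 + tanh z) (principal branch:
   sqrtc is the principal square root, Re >= 0, cut along the negative reals) *)
Definition cexp (z : CR) : CR :=
  limn (series (fun k => (z ^+ k / (k`!)%:R : CR^o))).
Definition ctanh (z : CR) : CR :=
  (cexp z - cexp (- z)) / (cexp z + cexp (- z)).
Definition Bfun (z : CR) : CR := @sqrtc Rdefinitions.R (1 + ctanh z).

Definition holomorphic_on (f : CR -> CR) (A : set CR) : Prop :=
  forall z, A z -> derivable (f : CR^o -> CR^o) z 1.

Definition cderiv (f : CR -> CR) (z : CR) : CR := derive1 (f : CR^o -> CR^o) z.

Definition subordinate (g h : CR -> CR) : Prop :=
  exists w : CR -> CR,
    [/\ w 0 = 0, (forall z, unit_disk z -> unit_disk (w z)),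
        holomorphic_on w unit_disk &
        forall z, unit_disk z -> g z = h (w z)].

Definition classS (a : nat -> CR) : Prop :=
  [/\ a 0%N = 0, a 1%N = 1,
      (forall z, unit_disk z -> cvgn (series (fun k => (a k * z ^+ k : CR^o)))) &
      (forall z1 z2, unit_disk z1 -> unit_disk z2 ->
         psum a z1 = psum a z2 -> z1 = z2)].

Definition classBT (a : nat -> CR) : Prop :=
  [/\ classS a, holomorphic_on (psum a) unit_disk &
      subordinate (cderiv (psum a)) Bfun].

Definition gamma1 (a : nat -> CR) : CR := (a 2%N) / 2.
Definition gamma2 (a : nat -> CR) : CR := (a 3%N - (a 2%N) ^+ 2 / 2) / 2.
Definition gamma3 (a : nat -> CR) : CR :=
  (a 4%N - a 2%N * a 3%N + (a 2%N) ^+ 3 / 3) / 2.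

Definition H21 (a : nat -> CR) : CR := gamma1 a * gamma3 a - (gamma2 a) ^+ 2.

(* Main.v *)
(* Write [f' = B o w] with [w = c1 z + c2 z^2 + c3 z^3 + ...] mapping the disk into
   itself. Comparing coefficients gives
     48 H21 = - 73/768 c1^4 - c1^2 c2 / 48 - c2^2 / 3 + 3/8 c1 c3,
   and each monomial is dominated in such a way that |48 H21| <= (|c1|^2 + |c2|^2 + |c3|^2) / 3;
   hence only the Parseval-type bound |c1|^2 + |c2|^2 + |c3|^2 <= 1 is needed.
   That bound is proved without integration: the four averages of [w] over the rotations
   by 4th roots of unity isolate c_k z^k up to O(z^(k+4)), the sum of the |average_k / z^k|^2
   is subharmonic in the sense of four-point means, and the maximum principle on |z| <= r < 1
   bounds its value at 0 by r^(-6). The expansions of [w] come from the differential equation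
   w' = u u' (e^(2w) + 1)^2 / (2 e^(2w)), u = f', by which [w] is infinitely differentiable.

   For sharpness, B is [e^(z/2) (cosh z)^(-1/2)]; the recursion of the coefficients of
   [(cosh z)^(-1/2)] bounds them by 1, so B is a power series [b] on the disk, and
   [f_2 = sum b_k z^(2k+1) / (2k+1)] is univalent since Re f_2' = Re B(z^2) > 0. *)
Require Import Defs.
From Stdlib Require Import Reals.
From mathcomp Require Import all_boot all_order all_algebra.
From mathcomp Require Import all_classical all_reals all_analysis.
From mathcomp Require Import Rstruct Rstruct_topology complex.
From mathcomp Require Import ring lra.
Import Order.TTheory GRing.Theory Num.Theory.
Import numFieldNormedType.Exports.
Local Open Scope ring_scope.
Local Open Scope complex_scope.

Set Implicit Arguments.
Unset Strict Implicit.
Unset Printing Implicit Defensive.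

(* A cast to [RR] opens [R_scope], hence the [%R] delimiters inside such casts. *)
Local Notation RR := Rdefinitions.R.
Local Notation Re := (@complex.Re Rdefinitions.R).
Local Notation Im := (@complex.Im Rdefinitions.R).

(** [holomorphic_on] grants one complex derivative at each point, so the Schwarz function [w] brings
    neither Taylor coefficients nor Cauchy estimates with it. On the side of [f] everything is a
    power series, and squaring [f' = B o w] removes the root: [f'^2 (e^(2w) + 1) = 2 e^(2w)].
    Differentiating this once makes [w'] a polynomial in [f'], [f''], [e^w] and [e^(-w)], hence
    differentiable again. Every estimate on remainders is a mean value inequality along a segment,
    in place of an integral. In the final inequality only [c2] is tight: its weight is exactly 1/3,
    while |c1|^2 collects 73/768 + 1/48 + 3/16 = 233/768 and |c3|^2 collects 3/16, both below 1/3.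
    This is why [w(z) = z^2], the Schwarz function of [f_2], gives equality. *)

Definition nm (z : CR) : RR := Re `|z|.

(** The norm of [CR] takes its values in [CR]; [nm] is the same modulus with values in the reals,
    where [lra] and [nra] apply. *)
Lemma norm_nm (z : CR) : `|z| = (nm z)%:C.
Proof. by rewrite /nm normc_def. Qed.

Lemma nm_def (z : CR) : nm z = Num.sqrt (Re z ^+ 2 + Im z ^+ 2).
Proof. by rewrite /nm normc_def. Qed.

Lemma nm_sqr z : nm z ^+ 2 = Re z ^+ 2 + Im z ^+ 2.
Proof. by rewrite nm_def sqr_sqrtr // addr_ge0 // sqr_ge0. Qed.

Lemma nm_ge0 z : 0 <= nm z.
Proof. by rewrite nm_def sqrtr_ge0. Qed.
#[local] Hint Resolve nm_ge0 : core.

Lemma nm0 : nm 0 = 0. Proof. by rewrite /nm normr0. Qed.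
Lemma nm1 : nm 1 = 1. Proof. by rewrite /nm normr1. Qed.
Lemma nmN z : nm (- z) = nm z. Proof. by rewrite /nm normrN. Qed.

Lemma nm_distC x y : nm (x - y) = nm (y - x).
Proof. by rewrite -nmN opprB. Qed.

Lemma nmM x y : nm (x * y) = nm x * nm y.
Proof. by apply: complexI; rewrite rmorphM /= -!norm_nm normrM. Qed.

Lemma nmX x n : nm (x ^+ n) = nm x ^+ n.
Proof. by elim: n => [|n IH]; rewrite ?expr0 ?nm1 // !exprS nmM IH. Qed.

Lemma nmV x : nm x^-1 = (nm x)^-1.
Proof. by apply: complexI; rewrite fmorphV /= -!norm_nm normfV. Qed.

Lemma nmD x y : nm (x + y) <= nm x + nm y.
Proof. by rewrite -lecR rmorphD /= -!norm_nm ler_normD. Qed.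

Lemma nmB x y : nm (x - y) <= nm x + nm y.
Proof. by rewrite -[nm y]nmN nmD. Qed.

Lemma nmBB x y : nm x - nm y <= nm (x - y).
Proof. by have := nmD (x - y) y; rewrite subrK; lra. Qed.

Lemma nm_eq0 x : (nm x == 0) = (x == 0).
Proof. by rewrite -(inj_eq (@complexI _)) /= -norm_nm normr_eq0. Qed.

Lemma nm_gt0 x : (0 < nm x) = (x != 0).
Proof. by rewrite lt_def nm_ge0 andbT nm_eq0. Qed.

Lemma nm_real (x : RR) : nm (x%:C) = `|x|.
Proof. by rewrite nm_def /= expr0n addr0 sqrtr_sqr. Qed.

Lemma nm_nat n : nm n%:R = n%:R.
Proof. by rewrite -(rmorph_nat (real_complex RR)) nm_real normr_nat. Qed.

Lemma nm_Re x : `|Re x| <= nm x.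
Proof. by rewrite nm_def -sqrtr_sqr ler_wsqrtr // lerDl sqr_ge0. Qed.

Lemma nm_Im x : `|Im x| <= nm x.
Proof. by rewrite nm_def -sqrtr_sqr ler_wsqrtr // lerDr sqr_ge0. Qed.

Lemma nm_ReIm x : nm x <= `|Re x| + `|Im x|.
Proof.
rewrite -(@ler_pXn2r _ 2) ?nnegrE ?nm_ge0 ?addr_ge0 //.
rewrite nm_sqr sqrrD !real_normK ?num_real //.
have := mulr_ge0 (normr_ge0 (Re x)) (normr_ge0 (Im x)); lra.
Qed.

Lemma nm_conj z : nm (z^*) = nm z.
Proof. by rewrite /nm normcJ. Qed.

Lemma mul_conj z : z * z^* = (nm z ^+ 2)%:C.
Proof. by rewrite -sqr_normc norm_nm rmorphXn. Qed.

Lemma nm_sum (I : Type) (s : seq I) (P : pred I) (F : I -> CR) :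
  nm (\sum_(i <- s | P i) F i) <= \sum_(i <- s | P i) nm (F i).
Proof.
elim/big_ind2: _ => [|x1 x2 y1 y2 h1 h2|//]; first by rewrite nm0.
by apply: (le_trans (nmD _ _)); apply: lerD.
Qed.

Lemma unit_diskE z : unit_disk z <-> nm z < 1.
Proof. by rewrite /unit_disk /= norm_nm -(ltcR (nm z) 1). Qed.

Lemma Re_add (x y : CR) : Re (x + y) = Re x + Re y. Proof. by case: x; case: y. Qed.
Lemma Im_add (x y : CR) : Im (x + y) = Im x + Im y. Proof. by case: x; case: y. Qed.
Lemma Re_opp (x : CR) : Re (- x) = - Re x. Proof. by case: x. Qed.
Lemma Im_opp (x : CR) : Im (- x) = - Im x. Proof. by case: x. Qed.
Lemma Re_mul (x y : CR) : Re (x * y) = Re x * Re y - Im x * Im y.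
Proof. by case: x; case: y. Qed.
Lemma Im_mul (x y : CR) : Im (x * y) = Re x * Im y + Im x * Re y.
Proof. by case: x => a b; case: y => c d. Qed.

(** * Complex differentiability *)

(** Stated over any [numFieldType] because it serves twice: over [CR] for complex derivatives, and
    over the reals for restrictions to segments. *)
Lemma is_deriveP (K : numFieldType) (f : K^o -> K^o) (x l : K) :
  is_derive (x : K^o) 1 f l <->
  (forall e : K, 0 < e -> exists2 d : K, 0 < d &
     forall h, `|h| < d -> `|f (x + h) - f x - l * h| <= e * `|h|).
Proof.
split.
- case=> df <- e e0.
  have := derivable_nbhs df.
  move=> /eqaddoP /(_ e e0) /=; rewrite near_simpl.
  move=> /nbhs_ballP[d /= d0 H]; exists d => // h hd.
  have := H h; rewrite /ball /= sub0r normrN => /(_ hd).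
  rewrite !fctE /= /GRing.scale /= mulr1 (addrC h x) [_ * h]mulrC.
  by rewrite opprD addrA.
- move=> H.
  suff C : ((fun h : K => h^-1 *: ((f \o shift (x:K^o)) (h *: (1:K^o)) - f x)) @ 0^' --> (l : K^o))%classic.
    by split; [apply/cvg_ex; exists l | apply/cvg_lim].
  apply/cvgrPdist_le => e e0.
  have [d d0 Hd] := H e e0.
  apply/nbhs_ballP; exists d => //= h; rewrite /ball /= sub0r normrN => hd h0.
  have := Hd h hd; rewrite /GRing.scale /= mulr1 (addrC h x) => H1.
  have hn0 : 0 < `|h| by rewrite normr_gt0.
  rewrite distrC -(ler_pM2r hn0) -normrM mulrBl mulrAC mulVf // mul1r.
  exact: H1.
Qed.

Definition cdif (f : CR -> CR) (z l : CR) : Prop :=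
  is_derive (z : CR^o) 1 (f : CR^o -> CR^o) l.

Lemma cdifP f z l : cdif f z l <->
  (forall e : RR, 0 < e -> exists2 d : RR, 0 < d &
     forall h, nm h < d -> nm (f (z + h) - f z - l * h) <= e * nm h).
Proof.
rewrite /cdif is_deriveP; split=> H e e0.
- have [|d d0 Hd] := H e%:C; first by rewrite (ltcR 0).
  have dr : d = (Re d)%:C by rewrite RRe_real // gtr0_real.
  rewrite dr (ltcR 0) in d0; exists (Re d) => // h hd.
  have := Hd h; rewrite dr !norm_nm ltcR => /(_ hd).
  by rewrite -rmorphM /= lecR.
- have er : e = (Re e)%:C by rewrite RRe_real // gtr0_real.
  rewrite er (ltcR 0) in e0.
  have [d d0 Hd] := H _ e0; exists d%:C; first by rewrite (ltcR 0).
  move=> h; rewrite !norm_nm ltcR => /Hd.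
  by rewrite er -rmorphM /= lecR.
Qed.

Lemma cdif_derivable f z l : cdif f z l -> derivable (f : CR^o -> CR^o) z 1.
Proof. by case. Qed.

Lemma cdif_cderiv f z l : cdif f z l -> cderiv f z = l.
Proof. by case=> _ <-; rewrite /cderiv derive1E. Qed.

Lemma derivable_cdif f z : derivable (f : CR^o -> CR^o) z 1 -> cdif f z (cderiv f z).
Proof. by move=> H; rewrite /cderiv derive1E; exact: DeriveDef. Qed.

Lemma cdif_uniq f z l1 l2 : cdif f z l1 -> cdif f z l2 -> l1 = l2.
Proof. by move=> /cdif_cderiv <- /cdif_cderiv. Qed.

Lemma cdif_eq f z l l' : cdif f z l -> l = l' -> cdif f z l'.
Proof. by move=> ? <-. Qed.

Lemma cdif_cst c z : cdif (fun=> c) z 0.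
Proof. exact: is_derive_cst. Qed.

Lemma cdif_id z : cdif id z 1.
Proof. exact: is_derive_id. Qed.

Lemma cdifD f g z l m : cdif f z l -> cdif g z m -> cdif (fun x => f x + g x) z (l + m).
Proof. by move=> ? ?; exact: is_deriveD. Qed.

Lemma cdifN f z l : cdif f z l -> cdif (fun x => - f x) z (- l).
Proof. by move=> ?; exact: is_deriveN. Qed.

Lemma cdifM f g z l m : cdif f z l -> cdif g z m ->
  cdif (fun x => f x * g x) z (f z * m + g z * l).
Proof. by move=> ? ?; exact: is_deriveM. Qed.

Lemma cdifV f z l : f z != 0 -> cdif f z l -> cdif (fun x => (f x)^-1) z (- (f z) ^- 2 * l).
Proof.
move=> f0 [df <-]; split; first exact: derivableV.
exact: deriveV.
Qed.

Lemma cdif_nbhs f g z l d : 0 < d -> (forall h, nm h < d -> f (z + h) = g (z + h)) ->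
  cdif f z l -> cdif g z l.
Proof.
move=> d0 E /cdifP H; apply/cdifP => e e0; have [d' d'0 Hd] := H e e0.
exists (Num.min d d'); first by rewrite lt_min d0.
move=> h; rewrite lt_min => /andP[h1 h2].
by rewrite -E // -[in g z](addr0 z) -E ?nm0 // addr0; exact: Hd.
Qed.

Lemma cdif_cont f z l : cdif f z l -> forall e, 0 < e -> exists2 d : RR, 0 < d &
  forall h, nm h < d -> nm (f (z + h) - f z) < e.
Proof.
move=> /cdifP /(_ 1 ltr01)[d d0 Hd] e e0.
have k0 : 0 < 1 + nm l by have := nm_ge0 l; lra.
exists (Num.min d (e / (1 + nm l))); first by rewrite lt_min d0 divr_gt0.
move=> h; rewrite lt_min => /andP[h1 h2].
have := Hd h h1; have := nmBB (f (z + h) - f z) (l * h); rewrite nmM.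
rewrite ltr_pdivlMr // in h2; lra.
Qed.

Lemma cdif_comp f g z l m : cdif f z l -> cdif g (f z) m ->
  cdif (fun x => g (f x)) z (m * l).
Proof.
move=> Hf /cdifP Hg; apply/cdifP => e e0.
have L0 := nm_ge0 l; have M0 := nm_ge0 m.
(* The error is the remainder of [g] at [k] plus [m] times the remainder of [f], each allotted
   [e / 2]. The cap at 1 gives [nm k <= (nm l + 1) * nm h]. *)
pose e1 := Num.min 1 (e / (2 * (1 + nm m))).
have e10 : 0 < e1 by rewrite lt_min ltr01 divr_gt0 //; lra.
have e11 : e1 <= 1 by rewrite ge_min lexx.
have e1m : nm m * e1 <= e / 2.
  have : e1 <= e / (2 * (1 + nm m)) by rewrite ge_min lexx orbT.
  rewrite ler_pdivlMr; last lra.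
  by nra.
pose e2 := e / (2 * (nm l + 1)).
have e20 : 0 < e2 by rewrite divr_gt0 //; lra.
have e2l : e2 * (nm l + 1) = e / 2 by rewrite /e2; field; apply/eqP; lra.
have [d2 d20 Hd2] := Hg _ e20.
have [d1 d10 Hd1] := (cdifP f z l).1 Hf _ e10.
have [d3 d30 Hd3] := cdif_cont Hf d20.
exists (Num.min d1 d3); first by rewrite lt_min d10.
move=> h; rewrite lt_min => /andP[h1 h3].
set k := f (z + h) - f z.
have kE : f (z + h) = f z + k by rewrite /k; ring.
have H2 := Hd2 k (Hd3 h h3); rewrite -kE in H2.
have H1 := Hd1 h h1; rewrite -/k in H1.
have -> : g (f (z + h)) - g (f z) - m * l * h =
  (g (f (z + h)) - g (f z) - m * k) + m * (k - l * h) by ring.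
apply: (le_trans (nmD _ _)); rewrite nmM.
have hk : nm k <= (nm l + 1) * nm h.
  have := nmBB k (l * h); rewrite nmM.
  have := nm_ge0 h; nra.
have := nm_ge0 h; have := nm_ge0 k; nra.
Qed.

Lemma real_cdif f z d l (lam : CR) (t : RR) : cdif f (z + t%:C * d) l ->
  is_derive (t : RR^o) 1 ((fun s : RR => Re (lam * f (z + s%:C * d))) : RR^o -> RR^o)
    (Re (lam * (l * d))).
Proof.
move=> /cdifP H; apply/is_deriveP => e e0.
have k0 : 0 < nm lam * nm d + 1 by have := mulr_ge0 (nm_ge0 lam) (nm_ge0 d); lra.
have [r r0 Hr] := H _ (divr_gt0 e0 k0).
have d0 : 0 < nm d + 1 by have := nm_ge0 d; lra.
exists (r / (nm d + 1)); first exact: divr_gt0.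
move=> h; rewrite ltr_pdivlMr // => hr.
have hd : nm (h%:C * d) < r by rewrite nmM nm_real; have := normr_ge0 h; lra.
have := Hr _ hd.
set X := (X in nm X); move=> HX.
have -> : Re (lam * f (z + (t + h)%:C * d)) - Re (lam * f (z + t%:C * d)) -
    Re (lam * (l * d)) * h = Re (lam * X).
  rewrite /X rmorphD /= mulrDl addrA.
  rewrite !mulrBr !Re_add !Re_opp; congr (_ - _).
  by rewrite !(Re_mul, Im_mul) /=; ring.
apply: (le_trans (nm_Re _)); rewrite nmM.
apply: (le_trans (ler_wpM2l (nm_ge0 lam) HX)).
rewrite nmM nm_real.
have -> : nm lam * (e / (nm lam * nm d + 1) * (`|h| * nm d)) =
  (nm lam * nm d) * (e / (nm lam * nm d + 1)) * `|h| by ring.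
apply: ler_wpM2r => //; rewrite mulrA ler_pdivrMr //.
by have := mulr_ge0 (nm_ge0 lam) (nm_ge0 d); nra.
Qed.

(** The mean value equality fails for complex values but holds for the real part of any fixed
    multiple of [f] on a segment. The factor [lam] is left free: a conjugate is put there both for
    the norm estimate and for univalence. *)
Lemma Re_MVT f g z d (lam : CR) :
  (forall t : RR, 0 <= t <= 1 -> cdif f (z + t%:C * d) (g (z + t%:C * d))) ->
  exists2 t : RR, 0 <= t <= 1 &
    Re (lam * (f (z + d) - f z)) = Re (lam * (g (z + t%:C * d) * d)).
Proof.
move=> H.
pose p (s : RR) := Re (lam * f (z + s%:C * d)).
pose dp (s : RR) := Re (lam * (g (z + s%:C * d) * d)).
have D (x : RR) : 0 <= x <= 1 -> is_derive (x : RR^o) 1 (p : RR^o -> RR^o) (dp x).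
  by move=> /H Hx; exact: (real_cdif lam Hx).
have D' (x : RR) : x \in `]0, 1[%R -> is_derive (x : RR^o) 1 (p : RR^o -> RR^o) (dp x).
  by rewrite in_itv /= => /andP[x0 x1]; apply: D; rewrite !ltW.
have C : ({within `[0, 1], continuous (p : RR^o -> RR^o)})%classic.
  apply: derivable_within_continuous => x; rewrite in_itv /= => x01.
  by case: (D x x01).
have [c] := MVT ltr01 D' C.
rewrite in_itv /= => /andP[c0 c1] E; exists c; first by rewrite !ltW.
move: E; rewrite /p /dp mul1r mul0r addr0 subr0 mulr1 => <-.
by rewrite mulrBr Re_add Re_opp.
Qed.

(** With [lam] the conjugate of the increment [D], the left side of [Re_MVT] is [|D|^2], and one
    factor [|D|] cancels. *)
Lemma MVT_nm f g z d (M : RR) :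
  (forall t : RR, 0 <= t <= 1 -> cdif f (z + t%:C * d) (g (z + t%:C * d))) ->
  (forall t : RR, 0 <= t <= 1 -> nm (g (z + t%:C * d)) <= M) ->
  nm (f (z + d) - f z) <= M * nm d.
Proof.
move=> H HM; set D := f (z + d) - f z.
have [t t01] := Re_MVT (D^*) H; rewrite -/D mulrC mul_conj [Re _]/= => E.
have [D0|D0] := eqVneq (nm D) 0.
  rewrite D0 mulr_ge0 //; apply: le_trans (HM 0 _) => //; by rewrite lexx ler01.
have Dp : 0 < nm D by rewrite lt_def D0 nm_ge0.
rewrite -(ler_pM2l Dp) -expr2 E.
apply: le_trans (ler_norm _) _; apply: le_trans (nm_Re _) _.
rewrite !nmM nm_conj ler_wpM2l // ler_wpM2r //; exact: HM.
Qed.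

Lemma MVT_pow f g z (r M : RR) n :
  (forall h, nm h < r -> cdif f (z + h) (g (z + h))) ->
  (forall h, nm h < r -> nm (g (z + h)) <= M * nm h ^+ n) ->
  forall h, nm h < r -> nm (f (z + h) - f z) <= M * nm h ^+ n.+1.
Proof.
move=> H HM h hr.
have hle (t : RR) : 0 <= t <= 1 -> nm (t%:C * h) <= nm h.
  by move=> /andP[t0 t1]; rewrite nmM nm_real ger0_norm // ler_piMl.
have M0 : 0 <= M * nm h ^+ n by apply: le_trans (HM h hr); exact: nm_ge0.
rewrite exprSr mulrA; apply: (@MVT_nm f g) => t t01; have ht := hle t t01.
  by apply: H; apply: le_lt_trans hr.
apply: le_trans (HM _ (le_lt_trans ht hr)) _.
(* [M] is not assumed nonnegative; its sign can be recovered only where [h] is nonzero. *)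
have [h0|h0] := eqVneq (nm h) 0.
  have -> // : nm (t%:C * h) = nm h.
  by apply/eqP; rewrite eq_le ht h0 nm_ge0.
have M1 : 0 <= M.
  by move: M0; rewrite pmulr_lge0 // exprn_gt0 // lt_def h0 nm_ge0.
by apply: ler_wpM2l => //; apply: lerXn2r; rewrite ?nnegrE ?nm_ge0.
Qed.

Lemma cdif_sum (F : nat -> CR -> CR) (l : nat -> CR) z n :
  (forall k, cdif (F k) z (l k)) ->
  cdif (fun x => \sum_(k < n) F k x) z (\sum_(k < n) l k).
Proof.
move=> H; elim: n => [|n IH].
  rewrite big_ord0; have -> : (fun x => \sum_(k < 0) F k x) = fun=> 0.
    by apply/funext => x; rewrite big_ord0.
  exact: cdif_cst.
rewrite big_ord_recr /=; have -> : (fun x => \sum_(k < n.+1) F k x) =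
    fun x => \sum_(k < n) F k x + F n x.
  by apply/funext => x; rewrite big_ord_recr.
exact: cdifD.
Qed.

Lemma cdif_pow z0 n z : cdif (fun x => (x - z0) ^+ n) z (n%:R * (z - z0) ^+ n.-1).
Proof.
have H1 : cdif (fun x => x - z0) z 1.
  by apply: cdif_eq (cdifD (cdif_id z) (cdif_cst (- z0) z)) _; rewrite addr0.
elim: n => [|n IH].
  rewrite mul0r; have -> : (fun x : CR => (x - z0) ^+ 0) = fun=> 1.
    by apply/funext => x; rewrite expr0.
  exact: cdif_cst.
have -> : (fun x : CR => (x - z0) ^+ n.+1) = fun x => (x - z0) * (x - z0) ^+ n.
  by apply/funext => x; rewrite exprS.
apply: cdif_eq (cdifM H1 IH) _.
case: n {IH} => [|n] /=; first by rewrite mul0r mulr0 add0r.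
by rewrite [X in _ = X * _]mulrSr exprS; ring.
Qed.

Lemma cdifZ c f z l : cdif f z l -> cdif (fun x => c * f x) z (c * l).
Proof.
by move=> H; apply: cdif_eq (cdifM (cdif_cst c z) H) _; rewrite mulr0 addr0.
Qed.

(** Induction on [n] over the shifted family: the derivative of [F 0] minus its Taylor polynomial is
    the same difference for [F 1], and [MVT_pow] gains one power of [nm h]. *)
Lemma taylor (F : nat -> CR -> CR) z (r : RR) n : 0 < r ->
  (forall k h, nm h < r -> cdif (F k) (z + h) (F k.+1 (z + h))) ->
  exists M : RR, exists2 d : RR, 0 < d & forall h, nm h < d ->
    nm (F 0%N (z + h) - \sum_(k < n) F k z / k`!%:R * h ^+ k) <= M * nm h ^+ n.
Proof.
move=> r0; elim: n F => [|n IH] F H.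
  have Hz : cdif (F 0%N) z (F 1%N z) by rewrite -[z]addr0; apply: H; rewrite nm0.
  have [d d0 Hd] := cdif_cont Hz (@ltr01 RR).
  exists (nm (F 0%N z) + 1), d => // h /Hd.
  rewrite big_ord0 subr0 expr0 mulr1.
  have := nmBB (F 0%N (z + h)) (F 0%N z); lra.
have [|M [d d0 Hd]] := IH (fun k => F k.+1); first by move=> k h; exact: H.
exists M, (Num.min d r); first by rewrite lt_min d0.
move=> h hd.
pose f x := F 0%N x - \sum_(k < n.+1) F k z / k`!%:R * (x - z) ^+ k.
pose g x := F 1%N x - \sum_(k < n) F k.+1 z / k`!%:R * (x - z) ^+ k.
have zz (x : CR) : z + x - z = x by ring.
have : nm (f (z + h) - f z) <= M * nm h ^+ n.+1.
  apply: (@MVT_pow f g z (Num.min d r)) => // k; rewrite lt_min => /andP[kd kr].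
    apply: cdifD; first exact: H.
    apply: cdifN.
    have Hs := cdif_sum n.+1 (fun j => cdifZ (F j z / j`!%:R) (cdif_pow z j (z + k))).
    apply: cdif_eq Hs _.
    rewrite big_ord_recl /= mul0r mulr0 add0r; apply: eq_bigr => i _ /=.
    rewrite /bump leq0n add1n add0n factS natrM.
    have n1 : (i.+1%:R : CR) != 0 by rewrite pnatr_eq0.
    have n2 : ((i`!)%:R : CR) != 0 by rewrite pnatr_eq0 -lt0n fact_gt0.
    move: (i.+1%:R : CR) (i`!%:R : CR) n1 n2 => a b a0 b0.
    by field; rewrite a0 b0.
  by rewrite /g zz; exact: Hd.
rewrite /f zz subrr.
have -> : \sum_(k < n.+1) F k z / k`!%:R * 0 ^+ k = F 0%N z.
  rewrite big_ord_recl /= expr0 mulr1 fact0 divr1 big1 ?addr0 // => i _.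
  by rewrite expr0n /= mulr0.
by rewrite subrr subr0.
Qed.

(** The tool for functional identities: an expression with zero derivative keeps its value at 0. *)
Lemma cdif0_const f z : (forall x, nm x < 1 -> cdif f x 0) -> nm z < 1 -> f z = f 0.
Proof.
move=> H z1; apply/eqP; rewrite -subr_eq0 -nm_eq0; apply/eqP/le_anti.
rewrite nm_ge0 andbT.
have := @MVT_nm f (fun=> 0) 0 z 0; rewrite mul0r add0r; apply.
- move=> t /andP[t0 t1]; apply: H; rewrite add0r nmM nm_real ger0_norm //.
  by apply: le_lt_trans z1; rewrite ler_piMl.
- by move=> t _; rewrite nm0.
Qed.

(** * Power series on the unit disk *)

Definition ccvg (u : nat -> CR) (l : CR) : Prop :=
  forall e : RR, 0 < e -> exists N, forall n, (N <= n)%N -> nm (u n - l) <= e.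

Lemma ccvgP u l : (((u : nat -> CR^o) @ \oo --> (l : CR^o))%classic) <-> ccvg u l.
Proof.
rewrite cvgrPdist_le; split=> H e e0.
- have /H : 0 < e%:C by rewrite (ltcR 0).
  case=> N _ HN; exists N => n Nn.
  by have := HN n Nn; rewrite /= norm_nm lecR nm_distC.
- have er : e = (Re e)%:C by rewrite RRe_real // gtr0_real.
  rewrite er (ltcR 0) in e0; have [N HN] := H _ e0.
  by exists N => // n /= Nn; rewrite er norm_nm lecR nm_distC; apply: HN.
Qed.

Lemma ccvg_limn u l : ccvg u l -> limn (u : nat -> CR^o) = l.
Proof. by move=> /ccvgP H; apply/cvg_lim. Qed.

Lemma ccvg_uniq u l l' : ccvg u l -> ccvg u l' -> l = l'.
Proof. by move=> /ccvg_limn <- /ccvg_limn. Qed.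

Lemma ccvgD u v l m : ccvg u l -> ccvg v m -> ccvg (fun n => u n + v n) (l + m).
Proof. by move=> /ccvgP Hu /ccvgP Hv; apply/ccvgP; exact: (cvgD Hu Hv). Qed.

Lemma ccvgB u v l m : ccvg u l -> ccvg v m -> ccvg (fun n => u n - v n) (l - m).
Proof. by move=> /ccvgP Hu /ccvgP Hv; apply/ccvgP; exact: (cvgB Hu Hv). Qed.

Lemma ccvgM u v l m : ccvg u l -> ccvg v m -> ccvg (fun n => u n * v n) (l * m).
Proof. by move=> /ccvgP Hu /ccvgP Hv; apply/ccvgP; exact: (cvgM Hu Hv). Qed.

Lemma ccvg_cst c : ccvg (fun=> c) c.
Proof. by move=> e e0; exists 0%N => n _; rewrite subrr nm0 ltW. Qed.

Lemma ccvg_sub u l (s : nat -> nat) : (forall n, (n <= s n)%N) ->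
  ccvg u l -> ccvg (fun n => u (s n)) l.
Proof.
move=> Hs H e /H[N HN]; exists N => n Nn; apply: HN.
exact: leq_trans (Hs n).
Qed.

Lemma ccvg_ext u v l : (forall n, u n = v n) -> ccvg u l -> ccvg v l.
Proof. by move=> E H e /H[N HN]; exists N => n /HN; rewrite E. Qed.

Lemma ccvg_le u l (B : RR) : ccvg u l -> (forall n, nm (u n) <= B) -> nm l <= B.
Proof.
move=> H HB; apply/ler_addgt0Pr => e e0; have [N HN] := H e e0.
have := HN N (leqnn N); have := HB N; have := nmBB l (u N).
rewrite nm_distC; lra.
Qed.

Lemma expn_to0 (q e : RR) : 0 <= q < 1 -> 0 < e ->
  exists N, forall n, (N <= n)%N -> q ^+ n <= e.
Proof.
move=> /andP[q0 q1] e0.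
have q1' : `|q| < 1 by rewrite ger0_norm.
have /cvgrPdist_le/(_ e e0)[N _ HN] := cvg_expr q1'.
exists N => n Nn; have := HN n Nn.
by rewrite /= sub0r normrN ger0_norm // exprn_ge0.
Qed.

Lemma geom_sum_le (q : RR) n : 0 <= q < 1 -> \sum_(k < n) q ^+ k <= (1 - q)^-1.
Proof.
move=> /andP[q0 q1].
have p : 0 < 1 - q by lra.
rewrite -[leRHS]mul1r ler_pdivlMr // mulrC.
have -> : (1 - q) * \sum_(k < n) q ^+ k = 1 - q ^+ n.
  by rewrite -(expr1n _ n) subrXX /= expr1n; congr (_ * _);
     apply: eq_bigr => i _; rewrite expr1n mul1r.
by have := exprn_ge0 n q0; lra.
Qed.

Lemma real_abs_cvg (R : realType) (w v : nat -> R) (B : R) :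
  (forall k, `|w k| <= v k) -> (forall n, \sum_(k < n) v k <= B) ->
  exists l : R, forall e, 0 < e -> exists N, forall n, (N <= n)%N ->
     `|\sum_(k < n) w k - l| <= e.
Proof.
move=> wv vB.
have v0 k : 0 <= v k by apply: le_trans (wv k).
have H : cvgn (series w).
  apply: normed_cvg.
  apply: (@series_le_cvg _ _ v) => //=.
  apply: nondecreasing_is_cvgn.
    by apply: nondecreasing_series => k _ _.
  by exists B => _ [n _ <-]; rewrite /series /= big_mkord.
exists (limn (series w)) => e e0.
have /cvgrPdist_le/(_ e e0)[N _ HN] := H.
exists N => n Nn; have := HN n Nn.
by rewrite distrC /series /= big_mkord.
Qed.

Lemma abs_ccvg (u : nat -> CR) (v : nat -> RR) (B : RR) :
  (forall k, nm (u k) <= v k) -> (forall n, \sum_(k < n) v k <= B) ->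
  exists l, ccvg (fun n => \sum_(k < n) u k) l.
Proof.
move=> uv vB.
have cv w wv := @real_abs_cvg _ w v B wv vB.
have [lr Hr] := cv (fun k => Re (u k)) (fun k => le_trans (nm_Re _) (uv k)).
have [li Hi] := cv (fun k => Im (u k)) (fun k => le_trans (nm_Im _) (uv k)).
exists (lr +i* li) => e e0.
have e2 : 0 < e / 2 by lra.
have [N1 H1] := Hr _ e2; have [N2 H2] := Hi _ e2.
exists (maxn N1 N2) => n; rewrite geq_max => /andP[/H1 h1 /H2 h2].
apply: le_trans (nm_ReIm _) _; rewrite Re_add Im_add Re_opp Im_opp /=.
have -> : Re (\sum_(k < n) u k) = \sum_(k < n) Re (u k).
  by elim/big_ind2: _ => // x1 x2 y1 y2 <- <-; rewrite Re_add.
have -> : Im (\sum_(k < n) u k) = \sum_(k < n) Im (u k).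
  by elim/big_ind2: _ => // x1 x2 y1 y2 <- <-; rewrite Im_add.
lra.
Qed.

(** Radius of convergence at least 1, expressed by bounded terms at each radius below 1; in this
    form it passes easily to derivatives and Cauchy products. *)
Definition tame (a : nat -> CR) : Prop := forall rho : RR, 0 < rho < 1 ->
  exists M : RR, forall k, nm (a k) * rho ^+ k <= M.

Lemma tame_bounded a (M : RR) : (forall k, nm (a k) <= M) -> tame a.
Proof.
move=> H rho /andP[r0 r1]; exists M => k.
have M0 : 0 <= M by apply: le_trans (H 0%N).
rewrite -[leRHS]mulr1; apply: ler_pM => //; first by apply: exprn_ge0; apply: ltW.
by rewrite exprn_ile1 // ltW.
Qed.

(** Boundedness at the intermediate radius [s] between [rho] and 1 gives a geometric majorant of
    ratio [rho / s]. *)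
Lemma tame_summable a rho : tame a -> 0 < rho < 1 ->
  exists C : RR, forall n, \sum_(k < n) nm (a k) * rho ^+ k <= C.
Proof.
move=> Ha /andP[r0 r1].
pose s := (1 + rho) / 2; have s0 : 0 < s by rewrite /s; lra.
have [|M HM] := Ha s; first by rewrite s0 /s; lra.
have M0 : 0 <= M by apply: le_trans (HM 0%N); rewrite mulr_ge0 // expr0.
pose q := rho / s; have q01 : 0 <= q < 1.
  by rewrite divr_ge0 ?ltW //= ltr_pdivrMr // mul1r /s; lra.
exists (M * (1 - q)^-1) => n.
apply: (@le_trans _ _ (\sum_(k < n) M * q ^+ k)).
  apply: ler_sum => k _.
  have -> : rho ^+ k = s ^+ k * q ^+ k.
    by rewrite -exprMn /q mulrCA mulfV ?mulr1 // gt_eqF.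
  by rewrite mulrA ler_wpM2r // exprn_ge0 //; case/andP: q01.
by rewrite -mulr_sumr ler_wpM2l // geom_sum_le.
Qed.

(** [1 - q^k] is [1 - q] times the sum of [q^j] for [j < k], and each of these is at least [q^k]. So
    [k q^k] is bounded by [1 / (1 - q)]. *)
Lemma muln_expn_le (q : RR) k : 0 <= q < 1 -> k%:R * (1 - q) * q ^+ k <= 1 - q ^+ k.
Proof.
move=> /andP[q0 q1]; elim: k => [|k IH]; first by rewrite !mul0r expr0 subrr.
have qk := exprn_ge0 k q0.
have qk1 : q ^+ k <= 1 by rewrite exprn_ile1 // ltW.
have q1' : 0 <= 1 - q by lra.
have qk' : 0 <= 1 - q ^+ k by lra.
rewrite exprS mulrSr.
have := ler_wpM2l q0 IH.
have := mulr_ge0 q1' qk'; have := mulr_ge0 (mulr_ge0 q1' q1') qk.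
move: (q ^+ k) (k%:R : RR) => Q K; nra.
Qed.

Lemma tame_muln a : tame a -> tame (fun k => k%:R * a k).
Proof.
move=> Ha rho /andP[r0 r1].
pose s := (1 + rho) / 2; have s0 : 0 < s by rewrite /s; lra.
have [|M HM] := Ha s; first by rewrite s0 /s; lra.
have M0 : 0 <= M by apply: le_trans (HM 0%N); rewrite mulr_ge0 // expr0.
pose q := rho / s; have q01 : 0 <= q < 1.
  by rewrite divr_ge0 ?ltW //= ltr_pdivrMr // mul1r /s; lra.
have q1 : 0 < 1 - q by case/andP: q01 => _; lra.
exists (M * (1 - q)^-1) => k.
have -> : rho ^+ k = s ^+ k * q ^+ k.
  by rewrite -exprMn /q mulrCA mulfV ?mulr1 // gt_eqF.
have -> : nm (k%:R * a k) * (s ^+ k * q ^+ k) = (nm (a k) * s ^+ k) * (k%:R * q ^+ k).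
  by rewrite nmM nm_nat; ring.
have q0 : 0 <= q by case/andP: q01.
apply: ler_pM => //; [by rewrite mulr_ge0 // exprn_ge0 // ltW
  | by rewrite mulr_ge0 // exprn_ge0|].
rewrite -[leRHS]mul1r ler_pdivlMr //.
have := muln_expn_le k q01; have := exprn_ge0 k q0; lra.
Qed.

Definition dcoef (a : nat -> CR) : nat -> CR := fun k => k.+1%:R * a k.+1.

Lemma tame_dcoef a : tame a -> tame (dcoef a).
Proof.
move=> /tame_muln Ha rho r01; have [M HM] := Ha rho r01.
have r0 : 0 < rho by case/andP: r01.
exists (M / rho) => k; rewrite ler_pdivlMr // -mulrA -exprSr; exact: (HM k.+1).
Qed.

Lemma psum_ccvg a z : tame a -> nm z < 1 ->
  ccvg (fun n => \sum_(k < n) a k * z ^+ k) (psum a z).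
Proof.
move=> Ha z1.
have r01 : 0 < (1 + nm z) / 2 < 1 by have := nm_ge0 z; lra.
have [C HC] := tame_summable Ha r01.
have [|l Hl] := @abs_ccvg (fun k => a k * z ^+ k)
  (fun k => nm (a k) * ((1 + nm z) / 2) ^+ k) C _ HC.
  move=> k; rewrite nmM nmX ler_wpM2l //; apply: lerXn2r; rewrite ?nnegrE //.
    by have := nm_ge0 z; lra.
  by have := nm_ge0 z; lra.
suff -> : psum a z = l by [].
apply: ccvg_limn; apply: ccvg_ext Hl => n.
by rewrite /series /= big_mkord.
Qed.

Lemma psum_cvgn a z : tame a -> nm z < 1 ->
  cvgn (series (fun k => (a k * z ^+ k : CR^o))).
Proof.
move=> Ha z1; apply/cvg_ex; exists (psum a z); apply/ccvgP.
by apply: ccvg_ext (psum_ccvg Ha z1) => n; rewrite /series /= big_mkord.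
Qed.

(** The terms of a convergent series tend to 0, hence are at most 1 from some rank on; the finite
    sum covers the earlier ones. *)
Lemma cvgn_tame a :
  (forall z, unit_disk z -> cvgn (series (fun k => (a k * z ^+ k : CR^o)))) -> tame a.
Proof.
move=> H rho /andP[r0 r1].
have /H : unit_disk (rho%:C) by apply/unit_diskE; rewrite nm_real gtr0_norm.
move=> /cvg_series_cvg_0 /ccvgP /(_ 1 ltr01)[N HN].
exists (1 + \sum_(k < N) nm (a k) * rho ^+ k) => k.
have nn j : 0 <= nm (a j) * rho ^+ j by rewrite mulr_ge0 // exprn_ge0 // ltW.
have [Nk|kN] := leqP N k.
  have := HN k Nk; rewrite subr0 nmM nmX nm_real gtr0_norm // => h.
  have : 0 <= \sum_(k < N) nm (a k) * rho ^+ k by apply: sumr_ge0.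
  lra.
rewrite (bigD1 (Ordinal kN)) //=.
have : 0 <= \sum_(i < N | i != Ordinal kN) nm (a i) * rho ^+ i by apply: sumr_ge0.
lra.
Qed.

(** The remainders satisfy [R_(k+1) = (z + h) R_k + k z^(k-1) h^2], and [k^2 + k <= (k+1)^2]. The
    factor [rho ^+ 2] on the left avoids the exponent [k - 2]; for [k = 0] the truncated [k.-1] is
    multiplied by 0. *)
Lemma exprB_bound (z h : CR) (rho : RR) k : 0 < rho < 1 -> nm z <= rho -> nm (z + h) <= rho ->
  nm ((z + h) ^+ k - z ^+ k - k%:R * z ^+ k.-1 * h) * rho ^+ 2
    <= k%:R ^+ 2 * rho ^+ k * nm h ^+ 2.
Proof.
move=> /andP[r0 r1] hz hx; elim: k => [|k IH].
  by rewrite !expr0 !mul0r subr0 subrr nm0 expr0n /= !mul0r.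
have -> : (z + h) ^+ k.+1 - z ^+ k.+1 - k.+1%:R * z ^+ k.+1.-1 * h =
   (z + h) * ((z + h) ^+ k - z ^+ k - k%:R * z ^+ k.-1 * h) + k%:R * z ^+ k.-1 * h ^+ 2.
  rewrite /= mulrSr; case: k {IH} => [|k] /=; first by rewrite !(expr0, expr1, mul0r); ring.
  by rewrite !exprS; ring.
apply: le_trans (ler_wpM2r _ (nmD _ _)) _; first by rewrite exprn_ge0 // ltW.
rewrite mulrDl nmM.
set R := nm (_ - _ - _) in IH *.
have h1 : nm (z + h) * R * rho ^+ 2 <= rho * (k%:R ^+ 2 * rho ^+ k * nm h ^+ 2).
  rewrite -mulrA; apply: ler_pM => //.
  by apply: mulr_ge0; [exact: nm_ge0 | rewrite exprn_ge0 // ltW].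
have h2 : nm (k%:R * z ^+ k.-1 * h ^+ 2) * rho ^+ 2 <= k%:R * rho ^+ k.+1 * nm h ^+ 2.
  rewrite !nmM !nmX nm_nat; case: k {IH R h1} => [|k] /=; first by rewrite !mul0r.
  rewrite [_ * nm h ^+ 2 * _]mulrAC; apply: ler_wpM2r; first by rewrite exprn_ge0.
  rewrite -mulrA; apply: ler_wpM2l; first exact: ler0n.
  rewrite -[k.+2]addn2 exprD; apply: ler_wpM2r; first by rewrite exprn_ge0 // ltW.
  by apply: lerXn2r; rewrite ?nnegrE // ltW.
apply: le_trans (lerD h1 h2) _.
have -> : rho * (k%:R ^+ 2 * rho ^+ k * nm h ^+ 2) + k%:R * rho ^+ k.+1 * nm h ^+ 2 =
  (k%:R ^+ 2 + k%:R) * (rho ^+ k.+1 * nm h ^+ 2) by rewrite [rho ^+ k.+1]exprS; ring.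
have -> : k.+1%:R ^+ 2 * rho ^+ k.+1 * nm h ^+ 2 =
  k.+1%:R ^+ 2 * (rho ^+ k.+1 * nm h ^+ 2) by ring.
apply: ler_wpM2r; first by rewrite mulr_ge0 // exprn_ge0 // ltW.
by rewrite mulrSr; have := ler0n RR k; nra.
Qed.

Lemma psum_cdif a z : tame a -> nm z < 1 -> cdif (psum a) z (psum (dcoef a) z).
Proof.
move=> Ha z1; have z0 := nm_ge0 z.
pose rho := (1 + nm z) / 2.
have r01 : 0 < rho < 1 by rewrite /rho; lra.
have r0 : 0 < rho by case/andP: r01.
(* [C] bounds the sums of [k^2 |a_k| rho^k], which majorize the quadratic remainders term by
   term. *)
have [C HC] := tame_summable (tame_muln (tame_muln Ha)) r01.
have C0 : 0 <= C by have := HC 0%N; rewrite big_ord0.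
have key h : nm h < rho - nm z ->
    nm (psum a (z + h) - psum a z - psum (dcoef a) z * h) <= C / rho ^+ 2 * nm h ^+ 2.
  move=> hr; have xr : nm (z + h) <= rho by have := nmD z h; lra.
  have zr : nm z <= rho by rewrite /rho; lra.
  have x1 : nm (z + h) < 1 by case/andP: r01 => _; lra.
  (* Partial sums of length [n.+1] here match those of length [n] for [dcoef a], whose indices are
     shifted by one. *)
  have H1 := ccvg_sub leqnSn (psum_ccvg Ha x1).
  have H2 := ccvg_sub leqnSn (psum_ccvg Ha z1).
  have H3 := ccvgM (psum_ccvg (tame_dcoef Ha) z1) (ccvg_cst h).
  apply: ccvg_le (ccvgB (ccvgB H1 H2) H3) _ => n /=.
  have -> : (\sum_(k < n) dcoef a k * z ^+ k) * h =
      \sum_(k < n.+1) a k * (k%:R * z ^+ k.-1 * h).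
    rewrite big_ord_recl /= !mul0r mulr0 add0r mulr_suml; apply: eq_bigr => i _.
    by rewrite /bump leq0n add1n /dcoef /=; ring.
  rewrite -!sumrB; apply: le_trans (nm_sum _ _ _) _.
  rewrite mulrAC ler_pdivlMr ?exprn_gt0 // mulr_suml.
  apply: le_trans (ler_wpM2r _ (HC n.+1)); last by rewrite exprn_ge0.
  rewrite mulr_suml; apply: ler_sum => i _.
  rewrite -!mulrBr !nmM !nm_nat -mulrA.
  have := ler_wpM2l (nm_ge0 (a i)) (exprB_bound i r01 zr xr).
  rewrite !mulrA -!(mulrAC _ (nm (a i))).
  by congr (_ <= _); ring.
apply/cdifP => e e0.
have k0 : 0 < C / rho ^+ 2 + 1.
  have : 0 <= C / rho ^+ 2 by rewrite divr_ge0 // exprn_ge0 // ltW.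
  lra.
exists (Num.min (rho - nm z) (e / (C / rho ^+ 2 + 1))).
  by rewrite lt_min divr_gt0 // andbT /rho; lra.
move=> h; rewrite lt_min ltr_pdivlMr // => /andP[h1 h2].
apply: le_trans (key h h1) _.
by rewrite expr2 mulrA ler_wpM2r //; have := nm_ge0 h; lra.
Qed.

Definition cprod (a b : nat -> CR) (n : nat) : CR := \sum_(i < n.+1) a i * b (n - i)%N.

Lemma cprod_bound a b rho : tame a -> tame b -> 0 < rho < 1 ->
  exists M : RR, forall n,
    (\sum_(i < n.+1) nm (a i) * nm (b (n - i)%N)) * rho ^+ n <= M.
Proof.
move=> Ha Hb r01; have [r0 r1] := andP r01.
have [C HC] := tame_summable Ha r01; have [M HM] := Hb rho r01.
have M0 : 0 <= M by apply: le_trans (HM 0%N); rewrite mulr_ge0 // expr0.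
exists (C * M) => n; apply: le_trans (ler_wpM2r M0 (HC n.+1)).
rewrite !mulr_suml; apply: ler_sum => i _.
have -> : rho ^+ n = rho ^+ i * rho ^+ (n - i) by rewrite -exprD subnKC // -ltnS.
rewrite mulrACA; apply: ler_wpM2l; last exact: HM.
by rewrite mulr_ge0 // exprn_ge0 // ltW.
Qed.

Lemma tame_cprod a b : tame a -> tame b -> tame (cprod a b).
Proof.
move=> Ha Hb rho r01; have [M HM] := cprod_bound Ha Hb r01; exists M => n.
apply: le_trans (HM n); apply: ler_wpM2r; first by rewrite exprn_ge0 // ltW //; case/andP: r01.
apply: le_trans (nm_sum _ _ _) _; apply: ler_sum => i _; by rewrite nmM.
Qed.

(** The product of two truncations of length [n] agrees with the Cauchy product below degree [n];
    what is left, in degrees [n] to [2n - 1], is bounded by a geometric sum of size [q ^+ n]. *)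
Lemma psum_cprod a b z : tame a -> tame b -> nm z < 1 ->
  psum (cprod a b) z = psum a z * psum b z.
Proof.
move=> Ha Hb z1; have z0 := nm_ge0 z.
have Hp := ccvgM (psum_ccvg Ha z1) (psum_ccvg Hb z1).
have Hc := psum_ccvg (tame_cprod Ha Hb) z1.
pose rho := (1 + nm z) / 2; have r01 : 0 < rho < 1 by rewrite /rho; lra.
have r0 : 0 < rho by case/andP: r01.
have [M HM] := cprod_bound Ha Hb r01.
have M0 : 0 <= M.
  apply: le_trans (HM 0%N); rewrite expr0 mulr1; apply: sumr_ge0 => i _.
  exact: mulr_ge0.
pose q := nm z / rho.
have q01 : 0 <= q < 1 by rewrite divr_ge0 // ?ltW //= ltr_pdivrMr // mul1r /rho; lra.
have q0 : 0 <= q by case/andP: q01.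
have p0 : 0 < 1 - q by case/andP: q01 => _; lra.
have zq n : nm z ^+ n = rho ^+ n * q ^+ n.
  by rewrite -exprMn /q mulrCA mulfV ?mulr1 // gt_eqF.
suff H0 : ccvg (fun n => (\sum_(k < n) a k * z ^+ k) * (\sum_(k < n) b k * z ^+ k) -
    \sum_(k < n) cprod a b k * z ^+ k) 0.
  have E := ccvg_uniq H0 (ccvgB Hp Hc).
  by apply/eqP; rewrite eq_sym -subr_eq0 -E.
have bnd n : nm ((\sum_(k < n) a k * z ^+ k) * (\sum_(k < n) b k * z ^+ k) -
    \sum_(k < n) cprod a b k * z ^+ k) <= M * (1 - q)^-1 * q ^+ n.
  pose A := \poly_(k < n) a k; pose B := \poly_(k < n) b k.
  have -> : \sum_(k < n) a k * z ^+ k = A.[z] by rewrite horner_poly.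
  have -> : \sum_(k < n) b k * z ^+ k = B.[z] by rewrite horner_poly.
  rewrite -hornerM.
  have sAB : (size (A * B)%R <= n + n)%N.
    apply: leq_trans (size_polyMleq _ _) _; apply: leq_trans (leq_pred _) _.
    by apply: leq_add; apply: size_poly.
  rewrite (horner_coef_wide _ sAB) big_split_ord /=.
  have -> : \sum_(i < n) (A * B)`_i * z ^+ i = \sum_(k < n) cprod a b k * z ^+ k.
    apply: eq_bigr => i _; congr (_ * _); rewrite coefM; apply: eq_bigr => j _.
    rewrite !coef_poly.
    have -> : (j < n)%N by apply: leq_ltn_trans (ltn_ord i); rewrite -ltnS.
    by have -> : (i - j < n)%N by apply: leq_ltn_trans (leq_subr _ _) (ltn_ord i).
  rewrite [X in nm (X - _)]addrC addrK; apply: le_trans (nm_sum _ _ _) _.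
  apply: (@le_trans _ _ (\sum_(k < n) M * q ^+ n * q ^+ k)).
    apply: ler_sum => k _; rewrite nmM nmX zq.
    rewrite -mulrA -exprD mulrA; apply: ler_wpM2r; first exact: exprn_ge0.
    apply: le_trans (HM (n + k)%N); apply: ler_wpM2r; first by rewrite exprn_ge0 // ltW.
    rewrite coefM; apply: le_trans (nm_sum _ _ _) _; apply: ler_sum => j _.
    rewrite nmM !coef_poly; apply: ler_pM => //; by case: ifP => // _; rewrite nm0.
  rewrite -mulr_sumr [M * _ * q ^+ n]mulrAC; apply: ler_wpM2l; last exact: geom_sum_le.
  by rewrite mulr_ge0 // exprn_ge0.
move=> e e0.
have k0 : 0 < M * (1 - q)^-1 + 1.
  have : 0 <= M * (1 - q)^-1 by rewrite divr_ge0 // ltW.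
  lra.
have [N HN] := expn_to0 q01 (divr_gt0 e0 k0).
exists N => n /HN; rewrite ler_pdivlMr // => h; rewrite subr0.
apply: le_trans (bnd n) _; have := exprn_ge0 n q0; lra.
Qed.

Lemma psum0 a : psum a 0 = a 0%N.
Proof.
apply: ccvg_limn => e e0; exists 1%N => -[//|n] _.
rewrite /series /= big_mkord big_ord_recl /= expr0 mulr1 big1 ?addr0 ?subrr ?nm0 ?ltW //.
by move=> i _; rewrite expr0n mulr0.
Qed.

Lemma psum_ext a b : a =1 b -> psum a =1 psum b.
Proof. by move=> /funext ->. Qed.

Lemma psumZ c a z : tame a -> nm z < 1 -> psum (fun k => c * a k) z = c * psum a z.
Proof.
move=> Ha z1; apply: ccvg_limn.
apply: ccvg_ext (ccvgM (ccvg_cst c) (psum_ccvg Ha z1)) => n.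
by rewrite /series /= big_mkord mulr_sumr; apply: eq_bigr => i _; rewrite mulrA.
Qed.

Lemma psumD a b z : tame a -> tame b -> nm z < 1 ->
  psum (fun k => a k + b k) z = psum a z + psum b z.
Proof.
move=> Ha Hb z1; apply: ccvg_limn.
apply: ccvg_ext (ccvgD (psum_ccvg Ha z1) (psum_ccvg Hb z1)) => n.
by rewrite /series /= big_mkord -big_split /=; apply: eq_bigr => i _; rewrite mulrDl.
Qed.

Lemma tameZ c a : tame a -> tame (fun k => c * a k).
Proof.
move=> Ha rho r01; have [M HM] := Ha rho r01; exists (nm c * M) => k.
by rewrite nmM -mulrA ler_wpM2l.
Qed.

(** * The exponential on the unit disk *)

(** Coefficients of [e^(lam z)]; the values 1, -1 and 1/2 of [lam] occur. *)
Definition ecoef (lam : CR) (k : nat) : CR := lam ^+ k / k`!%:R.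

Lemma ecoef_tame lam : nm lam <= 1 -> tame (ecoef lam).
Proof.
move=> l1; apply: (@tame_bounded _ 1) => k.
rewrite nmM nmX nmV nm_nat.
have k1 : (1%R : RR) <= k`!%:R by rewrite ler1n fact_gt0.
have k0 : (0%R : RR) < k`!%:R by rewrite ltr0n fact_gt0.
rewrite ler_pdivrMr // mul1r.
by apply: le_trans k1; rewrite exprn_ile1.
Qed.

Lemma dcoef_ecoef lam k : dcoef (ecoef lam) k = lam * ecoef lam k.
Proof.
rewrite /dcoef /ecoef factS natrM exprS.
have n1 : (k.+1%:R : CR) != 0 by rewrite pnatr_eq0.
have n2 : ((k`!)%:R : CR) != 0 by rewrite pnatr_eq0 -lt0n fact_gt0.
move: (k.+1%:R : CR) (k`!%:R : CR) n1 n2 => a b a0 b0.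
by field; rewrite a0 b0.
Qed.

Definition cexps (lam z : CR) := psum (ecoef lam) z.

Lemma cexps_cdif lam z : nm lam <= 1 -> nm z < 1 ->
  cdif (cexps lam) z (lam * cexps lam z).
Proof.
move=> l1 z1; have Ht := ecoef_tame l1.
apply: cdif_eq (psum_cdif Ht z1) _.
by rewrite (psum_ext (dcoef_ecoef lam)) psumZ.
Qed.

Lemma cexps_0 lam : cexps lam 0 = 1.
Proof. by rewrite /cexps psum0 /ecoef expr0 fact0 divr1. Qed.

Lemma cexpE z : cexp z = cexps 1 z.
Proof.
rewrite /cexp /cexps /psum.
suff -> : (fun k => (z ^+ k / (k`!)%:R : CR^o)) = (fun k => (ecoef 1 k * z ^+ k : CR^o)) by [].
apply/funext => k; by rewrite /ecoef expr1n mul1r mulrC.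
Qed.

Lemma cexpNE z : cexp (- z) = cexps (-1) z.
Proof.
rewrite /cexp /cexps /psum.
suff -> : (fun k => ((- z) ^+ k / (k`!)%:R : CR^o)) =
    (fun k => (ecoef (-1) k * z ^+ k : CR^o)) by [].
apply/funext => k; by rewrite /ecoef exprNn mulrAC.
Qed.

Lemma nmN1 : nm (-1) <= 1. Proof. by rewrite nmN nm1. Qed.
Lemma nm1_le1 : nm 1 <= 1. Proof. by rewrite nm1. Qed.

Lemma cexps_inv z : nm z < 1 -> cexps 1 z * cexps (-1) z = 1.
Proof.
move=> z1; rewrite (@cdif0_const (fun z => cexps 1 z * cexps (-1) z)) //.
  by rewrite !cexps_0 mulr1.
move=> x x1; apply: cdif_eq (cdifM (cexps_cdif nm1_le1 x1) (cexps_cdif nmN1 x1)) _.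
by move: (cexps 1 x) (cexps (-1) x) => u v; ring.
Qed.

Lemma nm_half : nm (1 / 2) = 1 / 2.
Proof. by rewrite nmM nm1 nmV nm_nat. Qed.

Lemma nm_half_le1 : nm (1 / 2) <= 1.
Proof. by rewrite nm_half; lra. Qed.

Lemma cexps_half z : nm z < 1 -> cexps (1 / 2) z ^+ 2 = cexps 1 z.
Proof.
move=> z1; suff H : cexps (1 / 2) z ^+ 2 * cexps (-1) z = 1.
  apply: (@mulIf _ (cexps (-1) z)); last by rewrite H cexps_inv.
  by apply/eqP => E; move/eqP: H; rewrite E mulr0 eq_sym oner_eq0.
rewrite expr2.
rewrite (@cdif0_const (fun z => cexps (1 / 2) z * cexps (1 / 2) z * cexps (-1) z)) //.
  by rewrite !cexps_0 !mulr1.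
move=> x x1; have H := cexps_cdif nm_half_le1 x1.
apply: cdif_eq (cdifM (cdifM H H) (cexps_cdif nmN1 x1)) _.
by move: (cexps (1 / 2) x) (cexps (-1) x) => u v; field.
Qed.

Lemma fact_ge_expn k : (2 ^ k <= k.+1`!)%N.
Proof.
by elim: k => // k IH; rewrite expnS factS leq_mul.
Qed.

(** Since [2^k <= (k+1)!], the series of [e^(z/2) - 1] is dominated by [1/2] times the geometric
    series of ratio 1/4, whose sum is 2/3. *)
Lemma cexps_half_near1 z : nm z < 1 -> nm (cexps (1 / 2) z - 1) <= 2 / 3.
Proof.
move=> z1; have Ht := ecoef_tame nm_half_le1.
have H := ccvg_sub leqnSn (psum_ccvg Ht z1).
apply: ccvg_le (ccvgB H (ccvg_cst 1)) _ => n.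
rewrite big_ord_recl /= {1}/ecoef !expr0 fact0 divr1 mulr1 addrC addKr.
apply: le_trans (nm_sum _ _ _) _.
have q01 : 0 <= ((1 / 4)%R : RR) < 1 by lra.
apply: (@le_trans _ _ (\sum_(k < n) 1 / 2 * (1 / 4) ^+ k)).
  apply: ler_sum => k _; rewrite /bump leq0n add1n /ecoef !nmM !nmX nm_half nmV nm_nat.
  have z1k : nm z ^+ k.+1 <= 1 by rewrite exprn_ile1 // ltW.
  apply: (@le_trans _ _ ((1 / 2) ^+ k.+1 / k.+1`!%:R)).
    by rewrite -[leRHS]mulr1; apply: ler_wpM2l.
  rewrite exprS -mulrA; apply: ler_wpM2l; first lra.
  have -> : ((1 / 4)%R : RR) = (1 / 2) * (1 / 2) by field.
  rewrite [leRHS]exprMn; apply: ler_wpM2l; first by rewrite exprn_ge0 //; lra.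
  rewrite div1r exprVn lef_pV2 ?posrE ?ltr0n ?fact_gt0 ?exprn_gt0 //.
  by rewrite -natrX ler_nat fact_ge_expn.
rewrite -mulr_sumr; have := geom_sum_le n q01.
have -> : ((1 - 1 / 4)%R : RR)^-1 = 4 / 3 by field.
lra.
Qed.

(** A number within 2/3 of 1 has argument below 45 degrees, because 2/3 is less than the sine of 45
    degrees; so its square, here [e^z], lies in the right half plane. *)
Lemma Re_cexp_gt0 z : nm z < 1 -> 0 < Re (cexps 1 z).
Proof.
move=> z1; rewrite -cexps_half //.
have H := cexps_half_near1 z1; set e := cexps (1 / 2) z in H *.
have : nm (e - 1) ^+ 2 <= 4 / 9 by move: (nm (e - 1)) (nm_ge0 (e - 1)) H => t t0 H; nra.
rewrite nm_sqr Re_add Im_add Re_opp Im_opp /= oppr0 addr0 [e ^+ 2]expr2 Re_mul.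
move: (Re e) (Im e) => x y; have := sqr_ge0 (x - 1 / 2); nra.
Qed.

Lemma cexps1_neq0 z : nm z < 1 -> cexps 1 z != 0.
Proof.
move=> z1; apply/eqP => E; have := Re_cexp_gt0 z1; by rewrite E /= ltxx.
Qed.

(** [e^(2z) = -1] would force [e^z] to be purely imaginary. This keeps the poles of [tanh] out of
    the disk. *)
Lemma cexps1_sqr_neq z : nm z < 1 -> cexps 1 z ^+ 2 + 1 != 0.
Proof.
move=> z1; apply/eqP => E; have := Re_cexp_gt0 z1.
set e := cexps 1 z in E *.
have := congr1 Re E; have := congr1 Im E.
rewrite Re_add Im_add expr2 Re_mul Im_mul /=.
move: (Re e) (Im e) => x y h1 h2 x0.
have y0 : y = 0.
  have : x * y = 0 by lra.
  by move=> /eqP; rewrite mulf_eq0 gt_eqF //= => /eqP.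
by rewrite y0 in h2; nra.
Qed.

Lemma ctanhE z : nm z < 1 -> 1 + ctanh z = 2 * cexps 1 z ^+ 2 / (cexps 1 z ^+ 2 + 1).
Proof.
move=> z1; rewrite /ctanh cexpE cexpNE.
have e0 := cexps1_neq0 z1; have e1 := cexps1_sqr_neq z1.
have -> : cexps (-1) z = (cexps 1 z)^-1.
  by apply: (mulfI e0); rewrite cexps_inv // mulfV.
have e2 : cexps 1 z + (cexps 1 z)^-1 != 0.
  apply/eqP => E; move/eqP: e1; apply.
  by rewrite -[RHS](mulr0 (cexps 1 z)) -E; field.
move: (cexps 1 z) e0 e1 e2 => e e0 e1 e2.
field; rewrite e1 /=; first [rewrite e0 | idtac]; rewrite ?e0 //.
Qed.

(** * A maximum principle *)

(** Perturb [S] by [e |z|^2], whose four-point sum exceeds four times the central value by exactly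
    [4 e t^2]. At an interior maximum this gain would beat the loss [C t^3] for small [t], so the
    maximum over the closed disk lies on the circle. *)
Lemma max_principle (S : CR -> RR) (r B : RR) : 0 < r ->
  (forall z, nm z <= r -> forall e, 0 < e -> exists2 d : RR, 0 < d &
     forall h, nm h < d -> `|S (z + h) - S z| < e) ->
  (forall z, nm z < r -> exists C : RR, exists2 d : RR, 0 < d &
     forall t : RR, 0 < t < d ->
       4 * S z - C * t ^+ 3 <= S (z + t%:C) + S (z + 0 +i* t) +
                               S (z - t%:C) + S (z - 0 +i* t)) ->
  (forall z, nm z = r -> S z <= B) -> S 0 <= B.
Proof.
move=> r0 Scont Ssub SB.
suff H e : 0 < e -> S 0 <= B + e * r ^+ 2.
  apply/ler_addgt0Pr => e e0; have r2 : 0 < r ^+ 2 by rewrite exprn_gt0.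
  by have := H _ (divr_gt0 e0 r2); rewrite divfK // gt_eqF.
(* Compactness of the disk is obtained in the product of two real segments, and [mk] carries it over
   to [CR]. *)
move=> e0; pose mk (p : RR^o * RR^o) : CR := p.1 +i* p.2.
pose T z := S z + e * nm z ^+ 2.
pose K : set (RR^o * RR^o) := [set p | nm (mk p) ^+ 2 <= r ^+ 2]%classic.
have inK p : K p -> nm (mk p) <= r.
  by rewrite /K /= ler_pXn2r // nnegrE ?nm_ge0 // ltW.
pose q2 (p : RR^o * RR^o) : RR^o := p.1 ^+ 2 + p.2 ^+ 2.
have q2c : (continuous q2)%classic.
  move=> p; apply: cvgD; rewrite expr2.
  - by apply: cvgM; exact: cvg_fst.
  - by apply: cvgM; exact: cvg_snd.
have q2E p : nm (mk p) ^+ 2 = q2 p by rewrite nm_sqr.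
have cK : compact K.
  apply: (@subclosed_compact _ _ (`[- r, r] `*` `[- r, r])%classic).
  - have -> : K = (q2 @^-1` [set x : RR^o | x <= r ^+ 2])%classic.
      by apply/seteqP; split=> p; rewrite /K /= q2E.
    by apply: closed_comp; [move=> p _; exact: q2c | exact: closed_le].
  - by apply: compact_setX; exact: segment_compact.
  - move=> p /inK pr /=; rewrite !in_itv /= -!ler_norml.
    by split; apply: le_trans pr; [apply: (nm_Re (mk p)) | apply: (nm_Im (mk p))].
have Tcont : ({within K, continuous (T \o mk : RR^o * RR^o -> RR^o)})%classic.
  apply: continuous_in_subspaceT => p; rewrite inE => /inK pr.
  have -> : T \o mk = (fun p => S (mk p) + e * q2 p).
    by apply/funext => x; rewrite /= /T q2E.
  have c1 : ({for p, continuous (S \o mk : RR^o * RR^o -> RR^o)})%classic.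
    apply/cvgrPdist_lt => s s0; have [d d0 Hd] := Scont _ pr s s0.
    have d2 : 0 < d / 2 by lra.
    exists (ball (p.1 : RR^o) (d / 2), ball (p.2 : RR^o) (d / 2)) => /=.
      by split; exact: nbhsx_ballx.
    move=> q [/= h1 h2]; rewrite distrC.
    have -> : mk q = mk p + (mk q - mk p) by rewrite [mk p + _]addrC subrK.
    apply: Hd; apply: le_lt_trans (nm_ReIm _) _.
    rewrite Re_add Im_add Re_opp Im_opp /= -(distrC p.1) -(distrC p.2).
    by move: h1 h2; rewrite /ball /=; lra.
  apply: (continuousD c1); apply: continuousM; last exact: q2c.
  exact: cst_continuous.
have K0 : K (0, 0).
  by rewrite /K /= nm_sqr /= expr0n addr0 exprn_ge0 // ltW.
have [|c] := @compact_EVT_max _ RR (T \o mk) K _ cK Tcont; first by exists (0, 0).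
rewrite inE => cin Hc; have cr := inK c cin; set z := mk c in cr.
have Hz x : nm x <= r -> T x <= T z.
  move=> xr; have := Hc (Re x, Im x); rewrite inE /=.
  have -> : mk (Re x, Im x) = x by case: (x).
  apply; rewrite /K /=; have -> : mk (Re x, Im x) = x by case: (x).
  by rewrite ler_pXn2r // nnegrE ?nm_ge0 // ltW.
have T0 : S 0 <= T z.
  have := Hz 0; rewrite nm0 {1}/T nm0 expr0n mulr0 addr0; apply; exact: ltW.
have [zr|zr] := ltP (nm z) r; last first.
  have E : nm z = r by apply/le_anti; rewrite cr zr.
  by apply: le_trans T0 _; rewrite /T E lerD2r; exact: SB.
exfalso; have [C [d d0 Hd]] := Ssub z zr.
(* The three bounds make [Ssub] applicable, keep the four points in the disk, and give
   [C t^3 <= 2 e t^2], half of the gain. *)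
pose t := Num.min (d / 2) (Num.min ((r - nm z) / 2) (2 * e / (`|C| + 1))).
have C1 : 0 < `|C| + 1 by have := normr_ge0 C; lra.
have t0 : 0 < t by rewrite !lt_min !divr_gt0 //; lra.
have td : t < d by apply: (@le_lt_trans _ _ (d / 2)); [rewrite ge_min lexx | lra].
have tr : nm z + t <= r.
  have : t <= (r - nm z) / 2 by rewrite !ge_min lexx orbT.
  lra.
have tC : t * (`|C| + 1) <= 2 * e.
  by rewrite -ler_pdivlMr // !ge_min lexx !orbT.
have CC : C * t ^+ 3 <= (2 * e) * t ^+ 2.
  have -> : C * t ^+ 3 = (t * C) * t ^+ 2 by ring.
  apply: ler_wpM2r; first by rewrite exprn_ge0 // ltW.
  apply: le_trans tC; apply: ler_wpM2l; first exact: ltW.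
  by have := ler_norm C; lra.
have nt : nm (t%:C) = t by rewrite nm_real gtr0_norm.
have nit : nm (0 +i* t) = t by rewrite nm_def /= expr0n add0r sqrtr_sqr gtr0_norm.
have := Hd t; rewrite t0 td => /(_ isT).
have p1 := Hz (z + t%:C) (le_trans (nmD _ _) _); rewrite nt in p1.
have p2 := Hz (z + 0 +i* t) (le_trans (nmD _ _) _); rewrite nit in p2.
have p3 := Hz (z - t%:C) (le_trans (nmB _ _) _); rewrite nt in p3.
have p4 := Hz (z - 0 +i* t) (le_trans (nmB _ _) _); rewrite nit in p4.
have := p1 tr; have := p2 tr; have := p3 tr; have := p4 tr.
rewrite /T !nm_sqr !(Re_add, Im_add, Re_opp, Im_opp) /=.
have t2 : 0 < e * t ^+ 2 by rewrite mulr_gt0 // exprn_gt0.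
move: (S _) (S _) (S _) (S _) (S z) => s1 s2 s3 s4 s.
move: (Re z) (Im z) => x y; nra.
Qed.

(** Parseval for the discrete Fourier transform of order 4. It is used for the rotations of [w] and
    for the four-point means of a quadratic polynomial. *)
Lemma parseval4 (x0 x1 x2 x3 : CR) :
  nm (x0 + x1 + x2 + x3) ^+ 2 + nm (x0 - 'i * x1 - x2 + 'i * x3) ^+ 2 +
  nm (x0 - x1 + x2 - x3) ^+ 2 + nm (x0 + 'i * x1 - x2 - 'i * x3) ^+ 2 =
  4 * (nm x0 ^+ 2 + nm x1 ^+ 2 + nm x2 ^+ 2 + nm x3 ^+ 2).
Proof.
rewrite !nm_sqr; case: x0 x1 x2 x3 => [a0 b0] [a1 b1] [a2 b2] [a3 b3].
by simpc; rewrite /=; ring.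
Qed.

(** * Second order expansions *)

Definition locb (g : CR -> CR) : Prop := exists M : RR, exists2 d : RR, 0 < d &
  forall h, nm h < d -> nm (g h) <= M.

Lemma locbD f g : locb f -> locb g -> locb (fun h => f h + g h).
Proof.
move=> [M [d d0 H]] [N [e e0 G]]; exists (M + N), (Num.min d e); first by rewrite lt_min d0.
move=> h; rewrite lt_min => /andP[/H h1 /G h2].
by apply: le_trans (nmD _ _) _; apply: lerD.
Qed.

Lemma locbM f g : locb f -> locb g -> locb (fun h => f h * g h).
Proof.
move=> [M [d d0 H]] [N [e e0 G]]; exists (M * N), (Num.min d e); first by rewrite lt_min d0.
move=> h; rewrite lt_min => /andP[/H h1 /G h2].
by rewrite nmM; apply: ler_pM.
Qed.

Lemma locb_cst c : locb (fun=> c).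
Proof. by exists (nm c), 1. Qed.

Lemma locb_id : locb id.
Proof. by exists 1, 1 => // h /ltW. Qed.

Lemma locb_rot w f : nm w = 1 -> locb f -> locb (fun h => f (w * h)).
Proof.
move=> w1 [M [d d0 H]]; exists M, d => // h hd; apply: H; by rewrite nmM w1 mul1r.
Qed.

(** The expansion is an equation for every [h], while [g] is controlled only near 0; sums and
    products of expansions thus become [ring] identities. *)
Definition exp2 (V : CR -> CR) (z : CR) : Prop := exists v1 v2 g, locb g /\
  forall h, V (z + h) = V z + v1 * h + v2 * h ^+ 2 + h ^+ 3 * g h.

(** The bound is asked only for nonzero [h], which suits functions defined by a separate value at
    [z]; at [h = 0] the quotient chosen for [g] is 0 by the convention on inverses. *)
Lemma exp2_bound V z v1 v2 (M d : RR) : 0 < d ->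
  (forall h, h != 0 -> nm h < d ->
     nm (V (z + h) - V z - v1 * h - v2 * h ^+ 2) <= M * nm h ^+ 3) -> exp2 V z.
Proof.
move=> d0 H; exists v1, v2, (fun h => (V (z + h) - V z - v1 * h - v2 * h ^+ 2) / h ^+ 3).
split.
  exists `|M|, d => // h hd; have [->|h0] := eqVneq h 0.
    by rewrite !expr0n /= invr0 mulr0 nm0.
  have hp : 0 < nm h ^+ 3 by rewrite exprn_gt0 // nm_gt0.
  rewrite nmM nmV nmX ler_pdivrMr //; apply: le_trans (H h h0 hd) _.
  by apply: ler_wpM2r; [exact: ltW | exact: ler_norm].
move=> h; have [->|h0] := eqVneq h 0.
  by rewrite !expr0n /= !mulr0 mul0r !addr0.
by rewrite [h ^+ 3 * _]mulrC divfK ?expf_neq0 //; ring.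
Qed.

Lemma exp2_nbhs f g z (d : RR) : 0 < d -> (forall h, nm h < d -> f (z + h) = g (z + h)) ->
  exp2 f z -> exp2 g z.
Proof.
move=> d0 E [v1 [v2 [p [[M [e e0 Hp]] Hf]]]].
have E0 : f z = g z by have := E 0; rewrite nm0 addr0; apply.
apply: (@exp2_bound g z v1 v2 M (Num.min d e)); first by rewrite lt_min d0.
move=> h _; rewrite lt_min => /andP[hd he]; rewrite -E // -E0 Hf.
have -> : f z + v1 * h + v2 * h ^+ 2 + h ^+ 3 * p h - f z - v1 * h - v2 * h ^+ 2 =
  h ^+ 3 * p h by ring.
by rewrite nmM nmX mulrC; apply: ler_wpM2r; [rewrite exprn_ge0 | exact: Hp].
Qed.

Lemma exp2_cst c z : exp2 (fun=> c) z.
Proof.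
exists 0, 0, (fun=> 0); split; first exact: locb_cst.
by move=> h; ring.
Qed.

Lemma exp2D f g z : exp2 f z -> exp2 g z -> exp2 (fun x => f x + g x) z.
Proof.
move=> [f1 [f2 [p [bp Hf]]]] [g1 [g2 [q [bq Hg]]]].
exists (f1 + g1), (f2 + g2), (fun h => p h + q h); split; first exact: locbD.
by move=> h; rewrite Hf Hg; ring.
Qed.

Lemma exp2M f g z : exp2 f z -> exp2 g z -> exp2 (fun x => f x * g x) z.
Proof.
move=> [f1 [f2 [p [bp Hf]]]] [g1 [g2 [q [bq Hg]]]].
exists (f z * g1 + f1 * g z), (f z * g2 + f1 * g1 + f2 * g z),
  (fun h => (f1 * g2 + f2 * g1) + (f2 * g2 * h + (p h * (g z + (g1 * h +
    (g2 * (h * h) + h * h * h * q h))) + q h * (f z + (f1 * h + f2 * (h * h)))))).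
split; last by move=> h; rewrite Hf Hg; ring.
by repeat first [apply: locbD | apply: locbM | exact: locb_cst | exact: locb_id | assumption].
Qed.

Lemma exp2X f z n : exp2 f z -> exp2 (fun x => f x ^+ n) z.
Proof.
move=> Hf; elim: n => [|n IH].
  have -> : (fun x => f x ^+ 0) = fun=> 1 by apply/funext => x; rewrite expr0.
  exact: exp2_cst.
have -> : (fun x => f x ^+ n.+1) = fun x => f x * f x ^+ n.
  by apply/funext => x; rewrite exprS.
exact: exp2M.
Qed.

Lemma exp2_rot w f z : nm w = 1 -> exp2 f (w * z) -> exp2 (fun x => f (w * x)) z.
Proof.
move=> w1 [f1 [f2 [p [bp Hf]]]].
exists (f1 * w), (f2 * w ^+ 2), (fun h => w ^+ 3 * p (w * h)); split.
  by apply: locbM; [exact: locb_cst | exact: locb_rot].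
by move=> h; rewrite mulrDr Hf; ring.
Qed.

Lemma exp2V z : z != 0 -> exp2 (fun x => x^-1) z.
Proof.
move=> z0; have zp : 0 < nm z by rewrite nm_gt0.
(* The remainder is exactly [- h^3 / (z^3 (z + h))], and [|z + h| >= |z| / 2] yields the constant
   [2 / |z|^4]. *)
apply: (@exp2_bound _ _ (- z ^- 2) (z ^- 3) (2 / nm z ^+ 4)%R (nm z / 2)%R); first lra.
move=> h _ hz.
have zh : nm z / 2 <= nm (z + h).
  by have := nmBB z (- h); rewrite opprK nmN; lra.
have zh0 : z + h != 0 by rewrite -nm_gt0; lra.
have -> : (z + h)^-1 - z^-1 - - z ^- 2 * h - z ^- 3 * h ^+ 2 = - (h ^+ 3 / (z ^+ 3 * (z + h))).
  by field; rewrite z0 zh0.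
rewrite nmN nmM nmV nmM !nmX mulrC; apply: ler_wpM2r; first by rewrite exprn_ge0.
have z3 : 0 < nm z ^+ 3 by rewrite exprn_gt0.
have zhp : 0 < nm (z + h) by lra.
rewrite ler_pdivlMr ?exprn_gt0 // mulrC ler_pdivrMr ?mulr_gt0 // exprSr.
have -> : 2 * (nm z ^+ 3 * nm (z + h)) = nm z ^+ 3 * (2 * nm (z + h)) by ring.
by apply: ler_wpM2l; [exact: ltW | lra].
Qed.

Lemma exp2_lip f z : exp2 f z -> exists M : RR, exists2 d : RR, 0 < d &
  forall h, nm h < d -> nm (f (z + h) - f z) <= M * nm h.
Proof.
move=> [f1 [f2 [p [bp Hf]]]].
have [M [d d0 Hd]] : locb (fun h => f1 + (f2 * h + h * h * p h)).
  by repeat first [apply: locbD | apply: locbM | exact: locb_cst | exact: locb_id | assumption].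
exists M, d => // h /Hd hM.
have -> : f (z + h) - f z = (f1 + (f2 * h + h * h * p h)) * h by rewrite Hf; ring.
by rewrite nmM ler_wpM2r.
Qed.

Lemma exp2_sqr_cont f z (e : RR) : exp2 f z -> 0 < e -> exists2 d : RR, 0 < d &
  forall h, nm h < d -> `|nm (f (z + h)) ^+ 2 - nm (f z) ^+ 2| < e.
Proof.
move=> /exp2_lip[M [d d0 H]] e0.
pose K := `|M| + 1; have K0 : 0 < K by rewrite /K; have := normr_ge0 M; lra.
(* With [D = |f (z + h) - f z| < 1], the two squares differ by at most [D (2 |f z| + D)], which is
   at most [D L]. *)
pose L := 2 * nm (f z) + 1; have L0 : 0 < L by rewrite /L; have := nm_ge0 (f z); lra.
have k0 : 0 < Num.min 1 (e / L) / K by rewrite divr_gt0 // lt_min ltr01 divr_gt0.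
exists (Num.min d (Num.min 1 (e / L) / K)); first by rewrite lt_min d0.
move=> h; rewrite lt_min => /andP[/H h1]; rewrite ltr_pdivlMr // lt_min.
rewrite ltr_pdivlMr // => /andP[h2 h3].
have hD : nm (f (z + h) - f z) <= nm h * K.
  apply: le_trans h1 _; rewrite mulrC; apply: ler_wpM2l => //.
  by have := ler_norm M; rewrite /K; lra.
have a1 := nmBB (f (z + h)) (f z); have a2 := nmBB (f z) (f (z + h)).
rewrite nm_distC in a2.
have D0 := nm_ge0 (f (z + h) - f z).
have x0 := nm_ge0 (f (z + h)); have y0 := nm_ge0 (f z).
move: (nm (f (z + h) - f z)) D0 hD a1 a2 => D D0 hD a1 a2.
rewrite ltr_norml; move: h3; rewrite /L.
move: (nm (f (z + h))) (nm (f z)) x0 y0 a1 a2 => x y x0 y0 a1 a2 h3.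
have DL : D * (2 * y + 1) < e.
  by apply: le_lt_trans h3; apply: ler_wpM2r => //; lra.
have D1 : D < 1 by lra.
have DD : D * D <= D by rewrite ler_piMl // ltW.
have h5 : x ^+ 2 - y ^+ 2 <= D * (2 * y + D) by nra.
have h6 : y ^+ 2 - x ^+ 2 <= D * (2 * y + D) by nra.
by nra.
Qed.

Lemma nm_sqrD_ge A B : nm A ^+ 2 - 2 * (nm A * nm B) <= nm (A + B) ^+ 2.
Proof.
have := nmBB A (- B); rewrite opprK nmN.
move: (nm A) (nm B) (nm (A + B)) (nm_ge0 A) (nm_ge0 B) (nm_ge0 (A + B)) => a b c a0 b0 c0 H.
have [ab|ab] := leP b a; nra.
Qed.

(** At the points [z + i^j t] the quadratic parts are the discrete Fourier transform of
    [(f z, f1 t, f2 t^2, 0)], so by [parseval4] their squared moduli sum to at least [4 |f z|^2].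
    The cubic remainder costs [2 K M t^3] at each point. *)
Lemma exp2_mean f z : exp2 f z -> exists C : RR, exists2 d : RR, 0 < d &
  forall t : RR, 0 < t < d ->
    4 * nm (f z) ^+ 2 - C * t ^+ 3 <= nm (f (z + t%:C)) ^+ 2 + nm (f (z + 0 +i* t)) ^+ 2 +
       nm (f (z - t%:C)) ^+ 2 + nm (f (z - 0 +i* t)) ^+ 2.
Proof.
move=> [f1 [f2 [p [[M [d d0 Hd]] Hf]]]].
pose K := nm (f z) + nm f1 + nm f2.
exists (8 * K * M), (Num.min d 1); first by rewrite lt_min d0 ltr01.
move=> t; rewrite lt_min => /andP[t0 /andP[td t1]].
have pt h : nm h = t -> nm (f z + f1 * h + f2 * h ^+ 2) ^+ 2 - 2 * K * M * t ^+ 3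
    <= nm (f (z + h)) ^+ 2.
  move=> ht; rewrite Hf; apply: le_trans (nm_sqrD_ge _ _).
  rewrite lerD2l lerN2 nmM nmX ht.
  have hM : nm (p h) <= M by apply: Hd; rewrite ht.
  have hK : nm (f z + f1 * h + f2 * h ^+ 2) <= K.
    apply: le_trans (nmD _ _) _; apply: lerD; last first.
      by rewrite nmM nmX ht ler_piMr // exprn_ile1 // ltW.
    by apply: le_trans (nmD _ _) _; rewrite lerD2l nmM ht ler_piMr // ltW.
  have t3 : 0 <= t ^+ 3 by rewrite exprn_ge0 // ltW.
  have := ler_pM (nm_ge0 _) (mulr_ge0 t3 (nm_ge0 (p h))) hK (ler_wpM2l t3 hM).
  lra.
have nt : nm (t%:C) = t by rewrite nm_real gtr0_norm.
have nit : nm (0 +i* t) = t by rewrite nm_def /= expr0n add0r sqrtr_sqr gtr0_norm.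
have p1 := pt _ nt; have p2 := pt _ nit.
have p3 := pt (- t%:C); rewrite nmN in p3; have {}p3 := p3 nt.
have p4 := pt (- (0 +i* t)); rewrite nmN in p4; have {}p4 := p4 nit.
have := parseval4 (f z) (f1 * t%:C) (f2 * t%:C ^+ 2) 0.
have iE : 0 +i* t = 'i * t%:C :> CR by simpc.
have i2 : ('i * t%:C) ^+ 2 = - t%:C ^+ 2 :> CR by rewrite exprMn sqr_i mulN1r.
move: p2 p4; rewrite iE => p2 p4; rewrite !sqrrN i2 in p2 p3 p4.
rewrite !mulr0 !addr0 !subr0 nm0 expr0n /= addr0.
have -> : f z - 'i * (f1 * t%:C) - f2 * t%:C ^+ 2 =
   f z + f1 * - ('i * t%:C) + f2 * - t%:C ^+ 2 by ring.
have -> : f z - f1 * t%:C + f2 * t%:C ^+ 2 = f z + f1 * - t%:C + f2 * t%:C ^+ 2 by ring.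
have -> : f z + 'i * (f1 * t%:C) - f2 * t%:C ^+ 2 =
   f z + f1 * ('i * t%:C) + f2 * - t%:C ^+ 2 by ring.
have b0 := sqr_ge0 (nm (f1 * t%:C)); have c0 := sqr_ge0 (nm (f2 * t%:C ^+ 2)).
lra.
Qed.

(** * Averages over rotations by the fourth roots of unity *)

Definition cI : CR := Complex 0 1.

Lemma cI_sqr2 : cI ^+ 2 = -1.
Proof. exact: sqr_i. Qed.

Lemma cI_sqr : cI * cI = -1.
Proof. by rewrite -expr2 cI_sqr2. Qed.

Lemma nm_cI : nm cI = 1.
Proof. by rewrite nm_def /= expr0n expr1n add0r sqrtr1. Qed.

Lemma cI_X : (cI ^+ 3 = - cI) * (cI ^+ 4 = 1) * (cI ^+ 5 = cI).
Proof.
have i4 : cI ^+ 4 = 1 by rewrite (exprM cI 2 2) cI_sqr2 sqrrN expr1n.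
by rewrite i4 exprS cI_sqr2 mulrN1 [_ ^+ 5]exprS i4 mulr1.
Qed.

Lemma nm_mean4 x0 x1 x2 x3 (B : RR) :
  nm x0 <= B -> nm x1 <= B -> nm x2 <= B -> nm x3 <= B -> nm ((x0 + x1 + x2 + x3) / 4) <= B.
Proof.
rewrite nmM nmV nm_nat.
have := nmD (x0 + x1 + x2) x3; have := nmD (x0 + x1) x2; have := nmD x0 x1; lra.
Qed.

Section FourRotations.
Variable w : CR -> CR.

(** The sum over [j < 4] of [i^(-jk) w(i^j z)]: four times the part of the series of [w] with
    exponents congruent to [k] modulo 4. Every index from 3 on is read as 3. *)
Definition rot4 (k : nat) (z : CR) : CR :=
  match k with
  | 0 => w z + w (cI * z) + w (-1 * z) + w (- cI * z)
  | 1 => w z - cI * w (cI * z) - w (-1 * z) + cI * w (- cI * z)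
  | 2 => w z - w (cI * z) + w (-1 * z) - w (- cI * z)
  | _ => w z + cI * w (cI * z) - w (-1 * z) - cI * w (- cI * z)
  end.

Lemma rot4_parseval z :
  nm (rot4 0 z) ^+ 2 + nm (rot4 1 z) ^+ 2 + nm (rot4 2 z) ^+ 2 + nm (rot4 3 z) ^+ 2 =
  4 * (nm (w z) ^+ 2 + nm (w (cI * z)) ^+ 2 + nm (w (-1 * z)) ^+ 2 + nm (w (- cI * z)) ^+ 2).
Proof. exact: parseval4. Qed.

Lemma rot4_exp2 k z : (forall c, nm c = 1 -> exp2 w (c * z)) -> exp2 (rot4 k) z.
Proof.
move=> H.
have H0 : exp2 w z by rewrite -[z]mul1r; apply: H; rewrite nm1.
have H1 : exp2 (fun x => w (cI * x)) z by apply: exp2_rot (H _ _); rewrite nm_cI.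
have H2 : exp2 (fun x => w (-1 * x)) z by apply: exp2_rot (H _ _); rewrite nmN nm1.
have H3 : exp2 (fun x => w (- cI * x)) z by apply: exp2_rot (H _ _); rewrite nmN nm_cI.
have HZ c f : exp2 f z -> exp2 (fun x => c * f x) z.
  by move=> Hf; apply: exp2M Hf; exact: exp2_cst.
have HN f : exp2 f z -> exp2 (fun x => - f x) z.
  move=> Hf; have -> : (fun x => - f x) = fun x => -1 * f x.
    by apply/funext => x; rewrite mulN1r.
  exact: HZ.
case: k => [|[|[|k]]] /=; repeat first [apply: exp2D | apply: HN | apply: HZ | assumption].
Qed.

(** After division by [h^k] the error must still be cubic, whence the exponent [k + 3]. For [k = 3]
    this is 6, which fixes the order of the Taylor expansion; the surviving terms [c 4] and [c 5]
    occur for [k = 0] and [k = 1]. *)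
Lemma rot4_taylor (c : nat -> CR) (M d : RR) k : (k < 4)%N ->
  (forall h, nm h < d -> nm (w h - \sum_(m < 6) c m * h ^+ m) <= M * nm h ^+ 6) ->
  forall h, nm h < Num.min d 1 ->
  nm (rot4 k h / 4 - c k * h ^+ k) <= (M + nm (c 4%N) + nm (c 5%N)) * nm h ^+ (k + 3).
Proof.
move=> k4 H h; rewrite lt_min => /andP[hd h1].
have h0 := nm_ge0 h.
have hpow i j : (j <= i)%N -> nm h ^+ i <= nm h ^+ j.
  by move=> ij; apply: ler_wiXn2l; rewrite // ltW.
have M0 : 0 <= M * nm h ^+ 6 by apply: le_trans (H h hd); exact: nm_ge0.
pose g x := w x - \sum_(m < 6) c m * x ^+ m.
have gE x : w x = c 0%N + c 1%N * x + c 2%N * x ^+ 2 + c 3%N * x ^+ 3 + c 4%N * x ^+ 4 +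
    c 5%N * x ^+ 5 + g x.
  have E : \sum_(m < 6) c m * x ^+ m = c 0%N + c 1%N * x + c 2%N * x ^+ 2 + c 3%N * x ^+ 3
      + c 4%N * x ^+ 4 + c 5%N * x ^+ 5.
    by rewrite !big_ord_recr big_ord0 /= add0r expr0 mulr1 expr1.
  by rewrite /g E addrC subrK.
have Hg a : nm a = 1 -> nm (g (a * h)) <= M * nm h ^+ 6.
  by move=> a1; have := H (a * h); rewrite nmM a1 mul1r; apply.
have g0 := H h hd; rewrite -/(g h) in g0.
have g1 := Hg cI nm_cI.
have g2 : nm (g (-1 * h)) <= M * nm h ^+ 6 by apply: Hg; rewrite nmN nm1.
have g3 : nm (g (- cI * h)) <= M * nm h ^+ 6 by apply: Hg; rewrite nmN nm_cI.
have MM : M * nm h ^+ 6 <= M * nm h ^+ (k + 3).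
  have [M1|M1] := leP 0 M.
    by apply: ler_wpM2l => //; apply: hpow; rewrite -[6%N]/(3 + 3)%N leq_add2r -ltnS.
  have h6 : nm h ^+ 6 = 0.
    apply/le_anti; rewrite exprn_ge0 // andbT; rewrite -(ler_nM2l M1) mulr0 //.
  have : nm h == 0 by move/eqP: h6; rewrite expf_eq0.
  by move=> /eqP ->; rewrite !expr0n addn3 /=.
(* [e] is the surviving term of degree 4 or 5, if any; the [x_j] are the Taylor remainders at the
   four rotated points, multiplied by fourth roots of unity. *)
suff [e [x0 [x1 [x2 [x3 [E [He [n0 [n1 [n2 n3]]]]]]]]]] :
  exists e x0 x1 x2 x3, rot4 k h / 4 - c k * h ^+ k = e + (x0 + x1 + x2 + x3) / 4 /\
   nm e <= (nm (c 4%N) + nm (c 5%N)) * nm h ^+ (k + 3) /\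
   nm x0 <= M * nm h ^+ 6 /\ nm x1 <= M * nm h ^+ 6 /\
   nm x2 <= M * nm h ^+ 6 /\ nm x3 <= M * nm h ^+ 6.
  rewrite E; apply: le_trans (nmD _ _) _.
  rewrite -[M + _ + _]addrA [M + _]addrC [leRHS]mulrDl; apply: lerD => //.
  by apply: le_trans MM; apply: nm_mean4.
have c4 : nm (c 4%N * h ^+ 4) <= (nm (c 4%N) + nm (c 5%N)) * nm h ^+ 3.
  rewrite nmM nmX; apply: ler_pM => //; first exact: exprn_ge0.
    by rewrite lerDl.
  exact: hpow.
have c5 : nm (c 5%N * h ^+ 5) <= (nm (c 4%N) + nm (c 5%N)) * nm h ^+ 4.
  rewrite nmM nmX; apply: ler_pM => //; first exact: exprn_ge0.
    by rewrite lerDr.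
  exact: hpow.
have z0 j : nm 0 <= (nm (c 4%N) + nm (c 5%N)) * nm h ^+ j.
  by rewrite nm0 mulr_ge0 ?exprn_ge0 // addr_ge0.
have w1 : w (cI * h) = c 0%N + cI * (c 1%N * h) - c 2%N * h ^+ 2 - cI * (c 3%N * h ^+ 3)
   + c 4%N * h ^+ 4 + cI * (c 5%N * h ^+ 5) + g (cI * h).
  rewrite gE !exprMn cI_sqr2 !cI_X. by ring.
have w2 : w (-1 * h) = c 0%N - c 1%N * h + c 2%N * h ^+ 2 - c 3%N * h ^+ 3
   + c 4%N * h ^+ 4 - c 5%N * h ^+ 5 + g (-1 * h).
  by rewrite gE; ring.
have w3 : w (- cI * h) = c 0%N - cI * (c 1%N * h) - c 2%N * h ^+ 2 + cI * (c 3%N * h ^+ 3)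
   + c 4%N * h ^+ 4 - cI * (c 5%N * h ^+ 5) + g (- cI * h).
  rewrite gE !exprMn !(exprNn cI) cI_sqr2 !cI_X; ring.
have ni x : nm (cI * x) = nm x by rewrite nmM nm_cI mul1r.
have ii x : cI * (cI * x) = - x :> CR by rewrite mulrA cI_sqr mulN1r.
case: k k4 {MM} => [|[|[|[|//]]]] _ /=; rewrite w1 w2 w3 {1}(gE h);
  move: (g h) (g (cI * h)) (g (-1 * h)) (g (- cI * h)) g0 g1 g2 g3 => e0 e1 e2 e3 g0 g1 g2 g3.
- exists (c 4%N * h ^+ 4), e0, e1, e2, e3; split; last by [].
  by move: cI (c 1%N * h) => I X; field.
- exists (c 5%N * h ^+ 5), e0, (- (cI * e1)), (- e2), (cI * e3).
  rewrite !nmN !ni; split; last by [].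
  by rewrite !(mulrDr cI) !(mulrN cI) !ii; move: cI (c 1%N * h) => I X; field.
- exists 0, e0, (- e1), e2, (- e3); rewrite !nmN; split; last by [].
  by move: cI (c 1%N * h) => I X; field.
- exists 0, e0, (cI * e1), (- e2), (- (cI * e3)).
  rewrite !nmN !ni; split; last by [].
  by rewrite !(mulrDr cI) !(mulrN cI) !ii; move: cI (c 1%N * h) => I X; field.
Qed.
End FourRotations.

Lemma bernoulli_le (x : RR) n : 0 <= x <= 1 -> 1 - n%:R * x <= (1 - x) ^+ n.
Proof.
move=> /andP[x0 x1]; elim: n => [|n IH]; first by rewrite expr0 mul0r subr0.
have y0 : 0 <= 1 - x by lra.
have := ler_wpM2l y0 IH; rewrite -exprS mulrSr.
have := ler0n RR n; move: (n%:R : RR) ((1 - x) ^+ n.+1) => N y N0.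
by have := mulr_ge0 N0 (mulr_ge0 x0 x0); lra.
Qed.

(** The passage [r -> 1] made explicit: for [r = 1 - x], Bernoulli's inequality gives
    [s <= 1 + n x s]. *)
Lemma le1_of_expn (s : RR) n : 0 <= s -> (forall r, 0 < r < 1 -> s * r ^+ n <= 1) -> s <= 1.
Proof.
move=> s0 H; apply/ler_addgt0Pr => e e0.
have k0 : 0 < n%:R * s + 1 by have := mulr_ge0 (ler0n RR n) s0; lra.
pose x := Num.min (1 / 2) (e / (n%:R * s + 1)).
have x0 : 0 < x by rewrite lt_min; apply/andP; split; [lra | exact: divr_gt0].
have x2 : x <= 1 / 2 by rewrite ge_min lexx.
have xe : x * (n%:R * s + 1) <= e by rewrite -ler_pdivlMr // ge_min lexx orbT.
have r01 : 0 < 1 - x < 1 by lra.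
have := H _ r01; have : 0 <= x <= 1 by lra.
by move=> /(bernoulli_le n)/(ler_wpM2l s0); nra.
Qed.

(** The maximum principle is applied to the sum of [|rot4 k / (4 z^k)|^2]. Its value at 0 is the sum
    in question, and on [|z| = r] it is at most [r^(-6)] by [rot4_parseval]. *)
Lemma schwarz_coef (F : nat -> CR -> CR) :
  (forall k z, nm z < 1 -> cdif (F k) z (F k.+1 z)) ->
  (forall z, nm z < 1 -> nm (F 0%N z) <= 1) ->
  \sum_(k < 4) nm (F k 0 / k`!%:R) ^+ 2 <= 1.
Proof.
move=> HF F1.
pose w := F 0%N; pose c m := F m 0 / m`!%:R.
(* The singularity at 0 is removable, with value [c k]; by [rot4_taylor] the expansion there has
   vanishing terms of degree 1 and 2. *)
pose V k z := if z == 0 then c k else rot4 w k z / 4 * (z^-1) ^+ k.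
pose S z := nm (V 0%N z) ^+ 2 + nm (V 1%N z) ^+ 2 + nm (V 2%N z) ^+ 2 + nm (V 3%N z) ^+ 2.
have chain z : nm z < 1 -> forall k h, nm h < 1 - nm z -> cdif (F k) (z + h) (F k.+1 (z + h)).
  by move=> z1 k h hz; apply: HF; apply: le_lt_trans (nmD _ _) _; lra.
have wexp z : nm z < 1 -> exp2 w z.
  move=> z1; have r0 : 0 < 1 - nm z by lra.
  have [M [d d0 H]] := taylor 3 r0 (chain z z1).
  apply: (@exp2_bound _ _ (F 1%N z) (F 2%N z / 2) M d d0) => h _ hd.
  have := H h hd; rewrite !big_ord_recr big_ord0 /= add0r fact0 divr1 expr0 mulr1.
  by rewrite divr1 expr1 !opprD !addrA.
have Vexp k z : (k < 4)%N -> nm z < 1 -> exp2 (V k) z.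
  move=> k4 z1; have [->|z0] := eqVneq z 0.
    have r0 : 0 < 1 - nm 0 by rewrite nm0; lra.
    have z01 : nm 0 < 1 by rewrite nm0.
    have [M [d d0 H]] := taylor 6 r0 (chain 0 z01).
    have H' h : nm h < d -> nm (w h - \sum_(m < 6) c m * h ^+ m) <= M * nm h ^+ 6.
      by move=> /H; rewrite add0r.
    have Hr := rot4_taylor k4 H'.
    apply: (@exp2_bound _ _ 0 0 (M + nm (c 4%N) + nm (c 5%N)) (Num.min d 1)).
      by rewrite lt_min d0 ltr01.
    move=> h h0 hd; rewrite !mul0r !subr0 add0r /V eqxx (negbTE h0).
    have hk : h ^+ k != 0 by rewrite expf_neq0.
    have -> : rot4 w k h / 4 * h^-1 ^+ k - c k = (rot4 w k h / 4 - c k * h ^+ k) * h^-1 ^+ k.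
      have hh : h ^+ k * h^-1 ^+ k = 1 by rewrite -exprMn mulfV // expr1n.
      by rewrite mulrBl -[c k * h ^+ k * _]mulrA hh mulr1.
    have hp : 0 < nm h ^+ k by rewrite exprn_gt0 // nm_gt0.
    rewrite nmM nmX nmV exprVn ler_pdivrMr //.
    by have := Hr h hd; rewrite addnC exprD mulrA.
  apply: (@exp2_nbhs (fun x => (rot4 w k x / 4) * (x^-1) ^+ k) _ _ (nm z)).
  - by rewrite nm_gt0.
  - move=> h hz; rewrite /V; case: eqP => // E.
    by move: hz; rewrite -[h](addKr z) E addr0 nmN ltxx.
  - apply: exp2M; last by apply: exp2X; exact: exp2V.
    apply: exp2M; last exact: exp2_cst.
    by apply: rot4_exp2 => a a1; apply: wexp; rewrite nmM a1 mul1r.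
suff HS r : 0 < r < 1 -> S 0 * r ^+ 6 <= 1.
  have -> : \sum_(k < 4) nm (F k 0 / k`!%:R) ^+ 2 = S 0.
    by rewrite !big_ord_recr big_ord0 /= add0r /S /V eqxx.
  apply: (@le1_of_expn _ 6) => //.
  by rewrite /S !addr_ge0 // exprn_ge0.
move=> /andP[r0 r1]; have r6 : 0 < r ^+ 6 by rewrite exprn_gt0.
rewrite -ler_pdivlMr // div1r.
apply: (@max_principle S r (r ^+ 6)^-1 r0).
- move=> z zr e e0; have z1 : nm z < 1 by lra.
  have e4 : 0 < e / 4 by lra.
  have [d0 p0 H0] := exp2_sqr_cont (Vexp 0%N z isT z1) e4.
  have [d1 p1 H1] := exp2_sqr_cont (Vexp 1%N z isT z1) e4.
  have [d2 p2 H2] := exp2_sqr_cont (Vexp 2%N z isT z1) e4.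
  have [d3 p3 H3] := exp2_sqr_cont (Vexp 3%N z isT z1) e4.
  exists (Num.min d0 (Num.min d1 (Num.min d2 d3))); first by rewrite !lt_min p0 p1 p2 p3.
  move=> h; rewrite !lt_min => /and4P[/H0 h0 /H1 h1 /H2 h2 /H3 h3].
  move: h0 h1 h2 h3; rewrite !ltr_norml /S => /andP[? ?] /andP[? ?] /andP[? ?] /andP[? ?].
  apply/andP; lra.
- move=> z zr; have z1 : nm z < 1 by lra.
  have [C0 [d0 p0 H0]] := exp2_mean (Vexp 0%N z isT z1).
  have [C1 [d1 p1 H1]] := exp2_mean (Vexp 1%N z isT z1).
  have [C2 [d2 p2 H2]] := exp2_mean (Vexp 2%N z isT z1).
  have [C3 [d3 p3 H3]] := exp2_mean (Vexp 3%N z isT z1).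
  exists (C0 + C1 + C2 + C3), (Num.min d0 (Num.min d1 (Num.min d2 d3))).
    by rewrite !lt_min p0 p1 p2 p3.
  move=> t; rewrite !lt_min => /andP[t0 /and4P[t0' t1 t2 t3]].
  have := H0 t; have := H1 t; have := H2 t; have := H3 t.
  rewrite t0 t0' t1 t2 t3 => /(_ isT) h3 /(_ isT) h2 /(_ isT) h1 /(_ isT) h0.
  rewrite /S; lra.
- move=> z zr; have z0 : z != 0 by rewrite -nm_gt0 zr.
  (* 16 is the square of the divisor 4, and [r^(-2k) <= r^(-6)] because [k <= 3] and [r < 1]. *)
  have Vb k : (k < 4)%N -> nm (V k z) ^+ 2 <= (16 * r ^+ 6)^-1 * nm (rot4 w k z) ^+ 2.
    move=> k4; rewrite /V (negbTE z0) !nmM nmX !nmV nm_nat zr.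
    have rk : (r^-1 ^+ k) ^+ 2 <= (r ^+ 6)^-1.
      rewrite -exprM exprVn lef_pV2 ?posrE ?exprn_gt0 //.
      by apply: ler_wiXn2l; rewrite ?ltW // -[6%N]/(3 * 2)%N leq_mul2r /= -ltnS.
    have -> : (nm (rot4 w k z) / 4 * r^-1 ^+ k) ^+ 2 =
      16^-1 * nm (rot4 w k z) ^+ 2 * (r^-1 ^+ k) ^+ 2.
      by move: (nm _) (r^-1 ^+ k) => x y; field.
    rewrite invfM [leRHS]mulrAC; apply: (ler_wpM2l _ rk).
    by rewrite mulr_ge0 ?exprn_ge0 // invr_ge0.
  have b0 := Vb 0%N isT; have b1 := Vb 1%N isT; have b2 := Vb 2%N isT; have b3 := Vb 3%N isT.
  have wb a : nm a = 1 -> nm (w (a * z)) ^+ 2 <= 1.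
    by move=> a1; rewrite exprn_ile1 // F1 // nmM a1 mul1r zr.
  have w0 := wb 1 nm1; rewrite mul1r in w0.
  have w1 := wb cI nm_cI.
  have w2 : nm (w (-1 * z)) ^+ 2 <= 1 by apply: wb; rewrite nmN nm1.
  have w3 : nm (w (- cI * z)) ^+ 2 <= 1 by apply: wb; rewrite nmN nm_cI.
  have P := rot4_parseval w z.
  have E : (r ^+ 6)^-1 = (16 * r ^+ 6)^-1 * 16 by field; rewrite gt_eqF.
  rewrite E /S; have k0 : 0 <= (16 * r ^+ 6)^-1 by rewrite invr_ge0 mulr_ge0 // ltW.
  have Q : nm (rot4 w 0 z) ^+ 2 + nm (rot4 w 1 z) ^+ 2 + nm (rot4 w 2 z) ^+ 2 +
     nm (rot4 w 3 z) ^+ 2 <= 16 by lra.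
  have := ler_wpM2l k0 Q; lra.
Qed.

(** * The Schwarz function of a member of the class *)

(* Closed under differentiation once [w'] itself belongs to it, so that a solution
   of [w' = Phi(u, u', exp w)] is infinitely differentiable. *)
Inductive dalg (w : CR -> CR) : (CR -> CR) -> Prop :=
| dalg_cst c : dalg w (fun=> c)
| dalg_psum b : tame b -> dalg w (psum b)
| dalg_exp : dalg w (fun z => cexps 1 (w z))
| dalg_expV : dalg w (fun z => (cexps 1 (w z))^-1)
| dalg_add f g : dalg w f -> dalg w g -> dalg w (fun z => f z + g z)
| dalg_mul f g : dalg w f -> dalg w g -> dalg w (fun z => f z * g z).

(** Only the two exponential generators produce a factor [w']; membership of [dw] closes the algebra
    there. *)
Lemma dalg_cdif w dw f :
  (forall z, nm z < 1 -> nm (w z) < 1) -> (forall z, nm z < 1 -> cdif w z (dw z)) ->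
  dalg w dw -> dalg w f -> exists2 g, dalg w g & forall z, nm z < 1 -> cdif f z (g z).
Proof.
move=> w1 Hw Hdw; elim=> {f}.
- by move=> c; exists (fun=> 0); [exact: dalg_cst | move=> z _; exact: cdif_cst].
- move=> b Hb; exists (psum (dcoef b)); first by apply: dalg_psum; exact: tame_dcoef.
  by move=> z z1; exact: psum_cdif.
- exists (fun z => cexps 1 (w z) * dw z); first by apply: dalg_mul => //; exact: dalg_exp.
  move=> z z1; have H := cdif_comp (Hw z z1) (cexps_cdif nm1_le1 (w1 z z1)).
  apply: cdif_eq H _.
  by rewrite mul1r.
- exists (fun z => -1 * ((cexps 1 (w z))^-1 * dw z)).
    apply: dalg_mul; first exact: dalg_cst.
    by apply: dalg_mul => //; exact: dalg_expV.
  move=> z z1; have e0 := cexps1_neq0 (w1 z z1).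
  have H := @cdifV (fun z => cexps 1 (w z)) z _ e0
    (cdif_comp (Hw z z1) (cexps_cdif nm1_le1 (w1 z z1))).
  apply: cdif_eq H _.
  by move: (cexps 1 (w z)) (dw z) e0 => e d e0; field.
- move=> f g _ [f' Af Hf] _ [g' Ag Hg]; exists (fun z => f' z + g' z).
    exact: dalg_add.
  by move=> z z1; apply: cdifD; [exact: Hf | exact: Hg].
- move=> f g Af0 [f' Af Hf] Ag0 [g' Ag Hg]; exists (fun z => f z * g' z + g z * f' z).
    by apply: dalg_add; apply: dalg_mul.
  by move=> z z1; apply: cdifM; [exact: Hf | exact: Hg].
Qed.

(** A derivative inside the algebra is selected by choice for each member, with an arbitrary value
    elsewhere, and iterated; membership is the invariant. *)
Lemma dalg_smooth w dw f :
  (forall z, nm z < 1 -> nm (w z) < 1) -> (forall z, nm z < 1 -> cdif w z (dw z)) ->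
  dalg w dw -> dalg w f ->
  exists2 F : nat -> CR -> CR, F 0%N = f &
    forall k z, nm z < 1 -> cdif (F k) z (F k.+1 z).
Proof.
move=> w1 Hw Hdw Hf.
have /choice[nxt Hn] : forall f, exists g, dalg w f ->
    dalg w g /\ forall z, nm z < 1 -> cdif f z (g z).
  move=> g; have [Ag|nA] := pselect (dalg w g); last by exists g.
  by have [g' ? ?] := dalg_cdif w1 Hw Hdw Ag; exists g'.
exists (fun k => iter k nxt f) => // k z z1.
suff : dalg w (iter k nxt f) by move=> /Hn[_]; apply.
by elim: k => [//|k /Hn[]].
Qed.

Lemma cdif_disk f g z l m : nm z < 1 -> (forall x, nm x < 1 -> f x = g x) ->
  cdif f z l -> cdif g z m -> l = m.
Proof.
move=> z1 E Hf Hg; have d0 : 0 < 1 - nm z by lra.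
apply: cdif_uniq Hg; apply: (cdif_nbhs d0 _ Hf).
by move=> h hz; apply: E; apply: le_lt_trans (nmD _ _) _; lra.
Qed.

(** Proof by explicit linear combination: the cofactors [c] and [c'] are supplied, and [ring] or
    [field] checks the identity. *)
Lemma lin_comb2 (c c' x y p q p' q' : CR) : p = q -> p' = q' ->
  x - y = c * (p - q) + c' * (p' - q') -> x = y.
Proof. by move=> -> ->; rewrite !subrr !mulr0 addr0 => /eqP; rewrite subr_eq0 => /eqP. Qed.

Section SchwarzODE.
Variables (a : nat -> CR) (w : CR -> CR).
Hypothesis Ha : tame a.
Hypothesis w0 : w 0 = 0.
Hypothesis w1 : forall z, nm z < 1 -> nm (w z) < 1.
Hypothesis Hw : forall z, nm z < 1 -> cdif w z (cderiv w z).
Hypothesis HB : forall z, nm z < 1 -> psum (dcoef a) z = Bfun (w z).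

Let u := psum (dcoef a).
Let u1 := psum (dcoef (dcoef a)).
Let e z := cexps 1 (w z).

Lemma schwarz_sqr z : nm z < 1 -> u z * u z * (e z * e z + 1) = 2 * (e z * e z).
Proof.
move=> z1; rewrite /u HB // -expr2 /Bfun sqr_sqrtc ctanhE ?w1 //.
have h := cexps1_sqr_neq (w1 z1); rewrite -/(e z) in h *.
by rewrite -expr2 divfK.
Qed.

(** Both relations come from differentiating [schwarz_sqr] and eliminating with it. The first
    expresses [w'] through [u], [u'] and [e], for smoothness; the second is free of the exponential,
    for comparing coefficients. *)
Lemma schwarz_deriv z : nm z < 1 ->
  cderiv w z * (4 * (e z * e z)) = 2 * u z * u1 z * (e z * e z + 1) * (e z * e z + 1) /\
  cderiv w z * (2 * u z - u z * u z * u z) = 2 * u1 z.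
Proof.
move=> z1; have He : cdif e z (e z * cderiv w z).
  have H := cdif_comp (Hw z1) (cexps_cdif nm1_le1 (w1 z1)).
  by apply: cdif_eq H _; rewrite mul1r.
have Hu : cdif u z (u1 z) by apply: psum_cdif => //; exact: tame_dcoef.
have Hee := cdifM He He.
have := cdif_disk z1 schwarz_sqr (cdifM (cdifM Hu Hu) (cdifD Hee (cdif_cst 1 z))) (cdifZ 2 Hee).
have := schwarz_sqr z1; have : e z != 0 by apply: cexps1_neq0; exact: w1.
move: (u z) (u1 z) (e z) (cderiv w z) => x x1 y d y0 E H; split.
  apply: (lin_comb2 (c := 2 * (y * y) * d) (c' := - (y * y + 1)) E H); ring.
apply: (@mulfI _ (2 * (y * y))); first by rewrite !mulf_neq0 // pnatr_eq0.
apply: (lin_comb2 (c := 2 * x1) (c' := - x) E H); ring.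
Qed.

(** The first relation of [schwarz_deriv] solved for [w'], written with the generators of [dalg]
    only. *)
Let dw z := u z * u1 z * ((e z * e z + 1) * (e z * e z + 1)) * (1 / 2 * ((e z)^-1 * (e z)^-1)).

Lemma schwarz_dw z : nm z < 1 -> cdif w z (dw z).
Proof.
move=> z1; apply: cdif_eq (Hw z1) _; have [E _] := schwarz_deriv z1.
have y0 : e z != 0 by apply: cexps1_neq0; exact: w1.
move: E; rewrite /dw; move: (u z) (u1 z) (e z) (cderiv w z) y0 => x x1 y d y0 E.
apply: (@mulIf _ (4 * (y * y))); first by rewrite !mulf_neq0 // pnatr_eq0.
by rewrite E; field.
Qed.

Lemma dalg_dw : dalg w dw.
Proof.
have He : dalg w e by exact: dalg_exp.
have Hi : dalg w (fun z => (e z)^-1) by exact: dalg_expV.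
have Hu : dalg w u by apply: dalg_psum; exact: tame_dcoef.
have Hu1 : dalg w u1 by apply: dalg_psum; do 2 apply: tame_dcoef.
have H1 : dalg w (fun z => e z * e z + 1).
  by apply: dalg_add (dalg_cst _ _); exact: dalg_mul.
apply: dalg_mul; first by apply: dalg_mul; apply: dalg_mul.
by apply: dalg_mul; [exact: dalg_cst | exact: dalg_mul].
Qed.

(** The relation [w' (2u - u^3) = 2u'] and its first two derivatives, taken at 0, determine [a 2],
    [a 3] and [a 4] in turn. *)
Lemma schwarz_expansion : a 1%N = 1 -> exists c1 c2 c3 : CR,
  [/\ a 2%N = c1 / 4, a 3%N = c2 / 6 - c1 ^+ 2 / 24,
      a 4%N = c3 / 8 - c1 * c2 / 16 - 5 / 192 * c1 ^+ 3 &
      nm c1 ^+ 2 + nm c2 ^+ 2 + nm c3 ^+ 2 <= 1].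
Proof.
move=> a1.
have [G G0 HG] := dalg_smooth w1 schwarz_dw dalg_dw dalg_dw.
pose F k := if k is j.+1 then G j else w.
have HF k z : nm z < 1 -> cdif (F k) z (F k.+1 z).
  by case: k => [|k] z1 /=; [rewrite G0; exact: schwarz_dw | exact: HG].
have F1 z : nm z < 1 -> nm (F 0%N z) <= 1 by move=> /w1/ltW.
have S := schwarz_coef HF F1.
pose u2 := psum (dcoef (dcoef (dcoef a))); pose u3 := psum (dcoef (dcoef (dcoef (dcoef a)))).
have Hu z : nm z < 1 -> cdif u z (u1 z).
  by move=> z1; apply: psum_cdif => //; exact: tame_dcoef.
have Hu1 z : nm z < 1 -> cdif u1 z (u2 z).
  by move=> z1; apply: psum_cdif => //; do 2 apply: tame_dcoef.
have Hu2 z : nm z < 1 -> cdif u2 z (u3 z).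
  by move=> z1; apply: psum_cdif => //; do 3 apply: tame_dcoef.
have E0 z : nm z < 1 -> G 0%N z * (2 * u z - u z * u z * u z) = 2 * u1 z.
  move=> z1; have [_ <-] := schwarz_deriv z1; congr (_ * _).
  by rewrite G0; apply: cdif_uniq (schwarz_dw z1) (Hw z1).
pose v z := 2 * u1 z - (u z * u z * u1 z + u z * (u z * u1 z + u z * u1 z)).
have Hv z : nm z < 1 -> cdif (fun z => 2 * u z - u z * u z * u z) z (v z).
  move=> z1; have H := Hu z z1; apply: cdifD; first exact: cdifZ.
  by apply: cdifN; exact: cdifM (cdifM H H) H.
have E1 z : nm z < 1 ->
    G 0%N z * v z + (2 * u z - u z * u z * u z) * G 1%N z = 2 * u2 z.
  move=> z1; exact: (cdif_disk z1 E0 (cdifM (HG 0%N z z1) (Hv z z1)) (cdifZ 2 (Hu1 z z1))).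
have n0 : nm 0 < 1 by rewrite nm0.
have HV : cdif v 0 (2 * u2 0 - ((u 0 * u 0 * u2 0 + u1 0 * (u 0 * u1 0 + u 0 * u1 0)) +
   (u 0 * ((u 0 * u2 0 + u1 0 * u1 0) + (u 0 * u2 0 + u1 0 * u1 0)) +
     (u 0 * u1 0 + u 0 * u1 0) * u1 0))).
  have H := Hu 0 n0; have H1 := Hu1 0 n0.
  apply: cdifD; first exact: cdifZ.
  apply: cdifN; apply: cdifD; first exact: cdifM (cdifM H H) H1.
  exact: cdifM H (cdifD (cdifM H H1) (cdifM H H1)).
have E2 := cdif_disk n0 E1 (cdifD (cdifM (HG 0%N 0 n0) HV) (cdifM (Hv 0 n0) (HG 1%N 0 n0)))
   (cdifZ 2 (Hu2 0 n0)).
move: (E0 0 n0) (E1 0 n0) E2; rewrite /v.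
have -> : u 0 = 1 by rewrite /u psum0 /dcoef a1 mulr1.
have -> : u1 0 = 2 * a 2%N by rewrite /u1 psum0 /dcoef mul1r.
have -> : u2 0 = 6 * a 3%N by rewrite /u2 psum0 /dcoef mul1r mulrA -natrM.
have -> : u3 0 = 24 * a 4%N by rewrite /u3 psum0 /dcoef mul1r !mulrA -!natrM.
move: S; rewrite !big_ord_recr big_ord0 /= w0 mul0r nm0 expr0n /= !add0r.
rewrite (_ : 1`! = 1%N) // (_ : 2`! = 2%N) // (_ : 3`! = 6%N) // divr1.
move: (G 0%N 0) (G 1%N 0) (G 2%N 0) => g0 g1 g2 S E3 E4 E5.
(* [g0], [g1] and [g2] are the first three derivatives of [w] at 0, so these are its Taylor
   coefficients. *)
exists g0, (g1 / 2), (g2 / 6).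
have n2 : a 2%N = g0 / 4.
  have -> : g0 = 4 * a 2%N.
    by rewrite -[LHS]mulr1; apply: (lin_comb2 (c := 1) (c' := 0) E3 E3); ring.
  by field.
have n3 : a 3%N = g1 / 2 / 6 - g0 ^+ 2 / 24.
  by apply: (lin_comb2 (c := - 1 / 12) (c' := 0) E4 E4); rewrite n2; field.
split=> //.
apply: (lin_comb2 (c := - 1 / 48) (c' := 0) E5 E5).
by rewrite n3 n2; field.
Qed.
End SchwarzODE.

(** * The bound on the Hankel determinant *)

Lemma H21E (a : nat -> CR) :
  48 * H21 a = a 2%N ^+ 4 - 12 * a 3%N ^+ 2 + 12 * a 2%N * a 4%N.
Proof. by rewrite /H21 /gamma1 /gamma2 /gamma3; field. Qed.

Lemma H21_bound a : classBT a -> nm (H21 a) <= 1 / 144.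
Proof.
case=> -[a0 a1 acv _] ah [w [w0 wd wh wB]].
have Ha : tame a by exact: cvgn_tame.
have w1 z : nm z < 1 -> nm (w z) < 1 by move=> /unit_diskE/wd/unit_diskE.
have Hw z : nm z < 1 -> cdif w z (cderiv w z).
  by move=> /unit_diskE/wh; exact: derivable_cdif.
have HB z : nm z < 1 -> psum (dcoef a) z = Bfun (w z).
  by move=> z1; rewrite -wB ?(cdif_cderiv (psum_cdif Ha z1)) //; apply/unit_diskE.
have [c1 [c2 [c3 [e2 e3 e4 S]]]] := schwarz_expansion Ha w0 w1 Hw HB a1.
have E : 48 * H21 a = - (73 / 768) * c1 ^+ 4 - c1 ^+ 2 * c2 / 48 - c2 ^+ 2 / 3 + 3 / 8 * (c1 * c3).
  by rewrite H21E e2 e3 e4; field.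
have : nm (48 * H21 a) <= 73 / 768 * nm c1 ^+ 4 + nm c1 ^+ 2 * nm c2 / 48 + nm c2 ^+ 2 / 3
    + 3 / 8 * (nm c1 * nm c3).
  rewrite E; apply: le_trans (nmD _ _) _; apply: lerD; last first.
    by rewrite !(nmX, nmM, nmV, nm_nat).
  apply: le_trans (nmB _ _) _; apply: lerD; last by rewrite !(nmX, nmM, nmV, nm_nat).
  apply: le_trans (nmB _ _) _; apply: lerD; last by rewrite !(nmX, nmM, nmV, nm_nat).
  by rewrite mulNr nmN !(nmX, nmM, nmV, nm_nat).
rewrite nmM nm_nat; move: S.
move: (nm c1) (nm c2) (nm c3) (nm_ge0 c1) (nm_ge0 c2) (nm_ge0 c3) => p q r p0 q0 r0 S H.
(* Each monomial is reduced to squares: [p^4] and [p^2 q] to [p^2], and [p r] to the mean of [p^2]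
   and [r^2]. The coefficients of [p^2], [q^2] and [r^2] are then 233/768, 1/3 and 3/16. *)
have pq : p ^+ 2 <= 1 by have := sqr_ge0 q; have := sqr_ge0 r; lra.
have q1 : q <= 1 by have := sqr_ge0 r; have := sqr_ge0 p; nra.
have p4 : p ^+ 4 <= p ^+ 2 by rewrite -[4%N]/(2 + 2)%N exprD ler_piMl // sqr_ge0.
have p2q : p ^+ 2 * q <= p ^+ 2 by rewrite ler_piMr // sqr_ge0.
have pr : 2 * (p * r) <= p ^+ 2 + r ^+ 2 by have := sqr_ge0 (p - r); nra.
have := sqr_ge0 p; have := sqr_ge0 r; lra.
Qed.

(** * The power series of [sqrt (1 + tanh z)] *)

(** Course-of-values recursion: [G n] receives the list of all earlier values. *)
Lemma strong_rec (T : Type) (G : nat -> seq T -> T) :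
  exists y : nat -> T, forall n, y n = G n (mkseq y n).
Proof.
pose ys := fix ys n := if n is m.+1 then rcons (ys m) (G m (ys m)) else [::].
exists (fun n => G n (ys n)) => n; congr (G n _).
by elim: n => [|n IH] //=; rewrite mkseqS -IH.
Qed.

Definition chcoef (k : nat) : CR := (ecoef 1 k + ecoef (-1) k) / 2.

Lemma chcoef0 : chcoef 0 = 1.
Proof. by rewrite /chcoef /ecoef !expr0 fact0 divr1; field. Qed.

Lemma chcoef1 : chcoef 1 = 0.
Proof. by rewrite /chcoef /ecoef !expr1 !divr1 subrr mul0r. Qed.

Lemma chcoef_le k : nm (chcoef k.+1) <= (1 / 2) ^+ k.
Proof.
have F : (k.+1`!%:R)^-1 <= ((1 / 2)%R : RR) ^+ k.
  rewrite div1r exprVn lef_pV2 ?posrE ?ltr0n ?fact_gt0 ?exprn_gt0 //.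
  by rewrite -natrX ler_nat fact_ge_expn.
rewrite /chcoef nmM nmV nm_nat.
have := nmD (ecoef 1 k.+1) (ecoef (-1) k.+1).
rewrite /ecoef !(nmX, nmM, nmV, nm_nat, nmN, nm1) !expr1n !mul1r; rewrite mul1r in F; lra.
Qed.

Lemma chcoef_tame : tame chcoef.
Proof.
apply: (@tame_bounded _ 1) => -[|k]; first by rewrite chcoef0 nm1.
by apply: le_trans (chcoef_le k) _; rewrite exprn_ile1 //; lra.
Qed.

Lemma psum_chcoef z : nm z < 1 -> psum chcoef z = (cexps 1 z + cexps (-1) z) / 2.
Proof.
move=> z1; have H1 := ecoef_tame nm1_le1; have H2 := ecoef_tame nmN1.
have -> : chcoef = fun k => 2^-1 * ecoef 1 k + 2^-1 * ecoef (-1) k.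
  by apply/funext => k; rewrite /chcoef; field.
rewrite psumD ?psumZ //; try exact: tameZ.
by rewrite /cexps; move: (psum _ z) (psum _ z) => p q; field.
Qed.

(* The coefficients of [(cosh z)^(-1/2)], read off [2 cosh y' + sinh y = 0]. *)
Lemma sech_coef : exists y : nat -> CR,
  [/\ y 0%N = 1, y 1%N = 0, (forall k, nm (y k) <= 1) &
    forall n, 2 * cprod chcoef (dcoef y) n + cprod (dcoef chcoef) y n = 0].
Proof.
(* The coefficient of [z^n] in the equation, solved for [y n.+1]: the terms with [chcoef j.+1] carry
   [2 (n - j) + (j + 1) = 2 (n + 1) - (j + 1)], to be divided by [2 (n + 1)]. *)
pose G m (s : seq CR) : CR := if m is n.+1 then
   - \sum_(j < n.+1) chcoef j.+1 * (1 - j.+1%:R / (2 * n.+1%:R)) * s`_(n - j)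
   else 1.
have [y Hy] := strong_rec G.
have yS n : y n.+1 =
    - \sum_(j < n.+1) chcoef j.+1 * (1 - j.+1%:R / (2 * n.+1%:R)) * y (n - j)%N.
  rewrite {1}Hy /=; congr (- _); apply: eq_bigr => j _.
  by rewrite nth_mkseq // ltnS leq_subr.
have y0 : y 0%N = 1 by rewrite Hy.
exists y; split=> //.
- by rewrite yS big_ord_recl big_ord0 /= chcoef1 !mul0r addr0 oppr0.
- move=> k; elim: k {-2}k (leqnn k) => [|k IH] m.
    by rewrite leqn0 => /eqP ->; rewrite y0 nm1.
  case: m => [_|m mk]; first by rewrite y0 nm1.
  rewrite yS nmN big_ord_recl /= chcoef1 !mul0r add0r.
  apply: le_trans (nm_sum _ _ _) _.
  (* As [chcoef 1 = 0], the remaining weights are at most 1/2, 1/4, and so on, with sum at most 1;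
     hence the bound 1 reproduces itself. *)
  apply: (@le_trans _ _ (\sum_(i < m) 1 / 2 * (1 / 2) ^+ i)).
    apply: ler_sum => i _; rewrite /bump leq0n add1n nmM (nmM (chcoef i.+2)) -exprS -[leRHS]mulr1.
    apply: ler_pM; rewrite ?mulr_ge0 //; last first.
      by apply: IH; apply: leq_trans (leq_subr _ _) _; rewrite -ltnS.
    rewrite -[leRHS]mulr1; apply: ler_pM => //; first exact: chcoef_le.
    have m0 : (0%R : RR) < m.+1%:R by rewrite ltr0n.
    have im : ((i.+2%:R)%R : RR) <= m.+1%:R by rewrite ler_nat ltnS.
    have -> : 1 - i.+2%:R / (2 * m.+1%:R) = ((1 - i.+2%:R / (2 * m.+1%:R))%R : RR)%:C.
      by rewrite rmorphB rmorph1 fmorph_div rmorphM !rmorph_nat.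
    rewrite nm_real ler_norml; have i0 := ler0n RR i.+2.
    have : (i.+2%:R / (2 * m.+1%:R))%R <= 1%R :> RR.
      by rewrite ler_pdivrMr ?mulr_gt0 //; lra.
    have : 0%R <= (i.+2%:R / (2 * m.+1%:R))%R :> RR by rewrite divr_ge0 // mulr_ge0 // ltW.
    by move: (i.+2%:R / _) => x h1 h2; apply/andP; split; lra.
  rewrite -mulr_sumr.
  have q01 : 0 <= ((1 / 2)%R : RR) < 1 by apply/andP; split; lra.
  have := geom_sum_le m q01; have -> : (((1 - 1 / 2)%R : RR))^-1 = 2 by field.
  lra.
- move=> n; rewrite /cprod /dcoef.
  rewrite big_ord_recl /= chcoef0 mul1r subn0 yS.
  have -> : \sum_(i < n) chcoef (bump 0 i) * ((n - bump 0 i).+1%:R * y (n - bump 0 i).+1) =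
    \sum_(i < n.+1) chcoef i.+1 * ((n - i)%:R * y (n - i)%N).
    rewrite [RHS]big_ord_recr /= subnn mul0r mulr0 addr0; apply: eq_bigr => i _.
    by rewrite /bump leq0n add1n subnSK.
  rewrite mulrN mulrDr mulrN [n.+1%:R * _]mulr_sumr !mulr_sumr -addrA -big_split /=.
  rewrite addrC -sumrB big1 // => i _.
  have n0 : (n.+1%:R : CR) != 0 by rewrite pnatr_eq0.
  have ni : (n.+1%:R : CR) = (n - i)%:R + i.+1%:R by rewrite -natrD addnS subnK // -ltnS.
  rewrite ni in n0 *; move: n0; move: (chcoef _) (y _) ((n - i)%:R : CR) (i.+1%:R : CR).
  by move=> c x p q pq; field.
Qed.

(** [psum b] and [Bfun] have the same square, so they agree up to sign. The sign is settled by
    [Re (psum b) > 0], which holds at 0 and persists because this real part never vanishes. *)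
Lemma Bfun_series : exists b : nat -> CR,
  [/\ b 0%N = 1, b 1%N = 1 / 2, tame b &
      forall z, nm z < 1 -> psum b z = Bfun z /\ 0 < Re (psum b z)].
Proof.
have [y [y0 y1 yb yode]] := sech_coef.
have Hy : tame y := tame_bounded yb.
have Hc := chcoef_tame.
have He := ecoef_tame nm_half_le1.
have ode z : nm z < 1 ->
    2 * (psum chcoef z * psum (dcoef y) z) + psum (dcoef chcoef) z * psum y z = 0.
  move=> z1; rewrite -!psum_cprod ?tame_dcoef //; try exact: tame_dcoef.
  have Hy' := tame_dcoef Hy; have Hc' := tame_dcoef Hc.
  have t1 := tame_cprod Hc Hy'; have t2 := tame_cprod Hc' Hy.
  rewrite -psumZ // -psumD //; last exact: tameZ.
  apply: ccvg_limn; apply: ccvg_ext (ccvg_cst 0) => n.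
  by rewrite /series /= big1 // => i _; rewrite yode mul0r.
have Y2 z : nm z < 1 -> psum y z * psum y z * psum chcoef z = 1.
  move=> z1; rewrite (@cdif0_const (fun z => psum y z * psum y z * psum chcoef z)) //.
    by rewrite !psum0 y0 chcoef0 !mulr1.
  move=> x x1; have H := psum_cdif Hy x1; have Hch := psum_cdif Hc x1.
  apply: cdif_eq (cdifM (cdifM H H) Hch) _.
  have := ode x x1.
  move: (psum y x) (psum chcoef x) (psum (dcoef y) x) (psum (dcoef chcoef) x) => p q p' q' E.
  by apply: (lin_comb2 (c := p) (c' := 0) E E); ring.
pose b := cprod (ecoef (1 / 2)) y; have Hb : tame b by exact: tame_cprod.
have b0 : b 0%N = 1.
  by rewrite /b /cprod big_ord_recl big_ord0 /= y0 /ecoef expr0 fact0 divr1 mulr1 addr0.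
have b1 : b 1%N = 1 / 2.
  rewrite /b /cprod !big_ord_recl big_ord0 /= /bump /= subn0 subnn y1 y0.
  by rewrite mulr0 add0r addr0 mulr1 /ecoef expr1 divr1.
have P2 z : nm z < 1 -> psum b z ^+ 2 * (cexps 1 z ^+ 2 + 1) = 2 * cexps 1 z ^+ 2.
  move=> z1; have Eb : psum b z = cexps (1 / 2) z * psum y z by exact: psum_cprod.
  rewrite Eb; move: (cexps_half z1); move: (cexps (1 / 2) z) => h Eh; rewrite exprMn Eh.
  have := Y2 z z1; rewrite psum_chcoef //.
  have := cexps_inv z1; have := cexps1_neq0 z1.
  move: (cexps 1 z) (cexps (-1) z) (psum y z) => e f p e0 ef E.
  apply: (lin_comb2 (c := 2 * e ^+ 2) (c' := - p ^+ 2 * e) E ef); by field.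
exists b; split=> // z z1.
(* If [psum b x = i q] with [q] real, then [e^(2x) (q^2 + 2) = - q^2] is real and nonpositive,
   against [Re (e^x) > 0]. *)
have ReP x : nm x < 1 -> Re (psum b x) != 0.
  move=> x1; apply/eqP => R0; have := P2 x x1; have := Re_cexp_gt0 x1.
  move: (psum b x) (cexps 1 x) R0 => p e R0 e0 E.
  have := congr1 Re E; have := congr1 Im E.
  rewrite !expr2 !(Re_mul, Im_mul, Re_add, Im_add) R0 /=.
  move: (Re e) (Im e) (Im p) e0 => s t q s0 E1 E2.
  have t0 : t = 0.
    have k0 : 0 < s * (q * q + 2) by rewrite mulr_gt0 //; have := sqr_ge0 q; lra.
    have : t * (s * (q * q + 2)) = 0 by lra.
    by move=> /eqP; rewrite mulf_eq0 (gt_eqF k0) orbF => /eqP.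
  rewrite t0 in E2; have : 0 < (s * s) * (q * q + 2).
    by rewrite mulr_gt0 ?mulr_gt0 //; have := sqr_ge0 q; lra.
  by have := sqr_ge0 q; lra.
have Rpos : 0 < Re (psum b z).
  (* Otherwise the intermediate value theorem on the segment from 0 to [z] yields a zero of the real
     part. *)
  rewrite ltNge; apply/negP => Rle.
  pose p (s : RR) : RR := Re (1 * psum b (0 + s%:C * z)).
  have sz (s : RR) : 0 <= s <= 1 -> nm (0 + s%:C * z) < 1.
    move=> /andP[s0 s1]; rewrite add0r nmM nm_real ger0_norm //.
    by apply: le_lt_trans z1; rewrite ler_piMl.
  have C : ({within `[0, 1], continuous (p : RR^o -> RR^o)})%classic.
    apply: derivable_within_continuous => x; rewrite in_itv /= => x01.
    by have [] := real_cdif 1 (psum_cdif Hb (sz x x01)).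
  have p0 : p 0 = 1 by rewrite /p mul1r mul0r add0r psum0 b0.
  have p1 : p 1 = Re (psum b z) by rewrite /p !mul1r add0r.
  have [|c] := IVT (v := 0) ler01 C.
    by rewrite p0 p1 ge_min le_max Rle ler01 orbT.
  rewrite in_itv /= /p mul1r => c01 c0.
  by have := ReP _ (sz c c01); rewrite c0 eqxx.
split=> //.
have Q : psum b z ^+ 2 = Bfun z ^+ 2.
  rewrite /Bfun sqr_sqrtc ctanhE // -P2 // mulfK //; exact: cexps1_sqr_neq.
have RB : 0 <= Re (Bfun z) by rewrite /Bfun; case: (1 + ctanh z) => ? ? /=; exact: sqrtr_ge0.
move/eqP: Q; rewrite eqf_sqr => /orP[/eqP //|/eqP E].
by exfalso; move: Rpos; rewrite E Re_opp; lra.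
Qed.

(** * The extremal function *)

Lemma sharp_example : exists a : nat -> CR,
  [/\ classBT a, (forall z, unit_disk z -> cderiv (psum a) z = Bfun (z ^+ 2)) &
      H21 a = - (1 / 144)].
Proof.
have [b [b0 b1 Hb HB]] := Bfun_series.
(* [q] lists the coefficients of [B(z^2)], and [a] those of its primitive vanishing at 0. *)
pose q k := if odd k then 0 else b k./2.
pose a n := if n is k.+1 then q k / k.+1%:R else 0.
have Hq : tame q.
  move=> rho /andP[r0 r1]; have r2 : 0 < rho ^+ 2 < 1.
    by rewrite exprn_gt0 //= expr_lt1 // ltW.
  have [M HM] := Hb _ r2; exists M => k.
  rewrite /q; case: ifP => ok.
    by rewrite nm0 mul0r; apply: le_trans (HM 0%N); rewrite mulr_ge0 // expr0.
  have hk : (k./2).*2 = k by rewrite -[RHS]odd_double_half ok.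
  by have := HM k./2; rewrite -exprM mul2n hk.
have dq : dcoef a =1 q.
  by move=> k; rewrite /dcoef /a mulrC divfK // pnatr_eq0.
have Ha : tame a.
  move=> rho r01; have [M HM] := Hq rho r01; have [r0 r1] := andP r01.
  exists M => -[|k] /=.
    by rewrite nm0 mul0r; apply: le_trans (HM 0%N); rewrite mulr_ge0 // expr0.
  apply: le_trans (HM k); apply: ler_pM => //; first by rewrite exprn_ge0 // ltW.
    rewrite nmM nmV nm_nat ler_piMr // invf_le1 ?ltr0n // ler1n //.
  by rewrite exprS ler_piMl // ?exprn_ge0 // ltW.
have sq z : nm z < 1 -> nm (z ^+ 2) < 1 by move=> z1; rewrite nmX expr_lt1.
have qz z : nm z < 1 -> psum q z = psum b (z ^+ 2).
  (* Along even lengths [n.*2] the partial sums for [q] at [z] equal those of length [n] for [b] at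
     [z^2]. *)
  move=> z1; have dn n : (n <= n.*2)%N by rewrite -addnn leq_addr.
  apply: ccvg_uniq (ccvg_sub dn (psum_ccvg Hq z1)) _.
  apply: ccvg_ext (psum_ccvg Hb (sq z z1)) => n.
  elim: n => [|n IH]; first by rewrite !big_ord0.
  rewrite doubleS !big_ord_recr /= -IH /q /= odd_double /= mul0r addr0 doubleK.
  by rewrite -exprM mul2n.
have D z : nm z < 1 -> cdif (psum a) z (psum b (z ^+ 2)).
  move=> z1; apply: cdif_eq (psum_cdif Ha z1) _.
  by rewrite (psum_ext dq) qz.
have BD z : unit_disk z -> cderiv (psum a) z = Bfun (z ^+ 2).
  move=> /unit_diskE z1; rewrite (cdif_cderiv (D z z1)).
  by have [-> _] := HB _ (sq z z1).
exists a; split; [|exact: BD|].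
- split.
  + split; [by [] | by rewrite /a /q /= b0 divr1 | |].
      by move=> z /unit_diskE z1; exact: psum_cvgn.
    move=> x y /unit_diskE x1 /unit_diskE y1 E.
    have seg (t : RR) : 0 <= t <= 1 -> nm (x + t%:C * (y - x)) < 1.
      move=> /andP[t0 t1].
      have -> : x + t%:C * (y - x) = (1 - t)%:C * x + t%:C * y.
        by rewrite rmorphB rmorph1; ring.
      have t1' : 0 <= 1 - t by lra.
      apply: le_lt_trans (nmD _ _) _; rewrite !nmM !nm_real !ger0_norm //.
      apply: (@le_lt_trans _ _ (Num.max (nm x) (nm y))); last by rewrite gt_max x1.
      have hx : nm x <= Num.max (nm x) (nm y) by rewrite le_max lexx.
      have hy : nm y <= Num.max (nm x) (nm y) by rewrite le_max lexx orbT.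
      by have := ler_wpM2l t1' hx; have := ler_wpM2l t0 hy; lra.
    (* With [lam] the conjugate of [y - x], equal values at [x] and [y] give [Re f' |y - x|^2 = 0]
       at some point of the segment, and [Re f' > 0] forces [x = y]. *)
    have [t t01] := Re_MVT (f := psum a) (g := fun z => psum b (z ^+ 2))
      ((y - x)^*) (fun t Ht => D _ (seg t Ht)).
    have -> : x + (y - x) = y by ring.
    rewrite E subrr mulr0 mulrCA [(y - x)^* * _]mulrC mul_conj.
    rewrite Re_mul /= mulr0 subr0 => /esym/eqP.
    have [_ Rp] := HB _ (sq _ (seg t t01)).
    rewrite mulf_eq0 (gt_eqF Rp) /= expf_eq0 /= nm_eq0 subr_eq0.
    by move=> /eqP.
  + by move=> z /unit_diskE z1; exact: cdif_derivable (D z z1).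
  + exists (fun z => z ^+ 2); split.
    * by rewrite expr0n.
    * by move=> z /unit_diskE z1; apply/unit_diskE; exact: sq.
    * move=> z _; have H := cdif_pow 0 2 z.
      apply: (@cdif_derivable _ _ (2%:R * (z - 0) ^+ 1)).
      have -> : (fun z : CR => z ^+ 2) = fun z => (z - 0) ^+ 2.
        by apply/funext => x; rewrite subr0.
      exact: H.
    * exact: BD.
(* Here [a 2] and [a 4] vanish and [a 3 = 1/6], so only [-12 (a 3)^2 = -1/3] remains. *)
- have : 48 * H21 a = 48 * - (1 / 144).
    by rewrite H21E /a /q /= b1 !mul0r; field.
  by apply: mulfI; rewrite pnatr_eq0.
Qed.

Theorem theorem2p1 :
  (forall a : nat -> CR, classBT a -> `|H21 a| <= 1 / 144)
  /\
  (exists a : nat -> CR,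
     [/\ classBT a,
         (forall z, unit_disk z -> cderiv (psum a) z = Bfun (z ^+ 2)) &
         `|H21 a| = 1 / 144]).
Proof.
have E : 1 / 144 = (1 / 144)%:C :> CR.
  by rewrite fmorph_div rmorph1 rmorph_nat.
split=> [a /H21_bound H|]; first by rewrite norm_nm E lecR.
have [a [Ha Hd HH]] := sharp_example; exists a; split=> //.
by rewrite HH norm_nm nmN E nm_real ger0_norm //; lra.
Qed.
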